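(* The restriction of the map $\mu$ to $\mathcal{D}_0$ is biregular onto $\mathbb{H}\setminus(-\infty,-1]$. For any positive $n\in\mathbb{N}$, the restriction of the map $\mu$ to $\mathcal{D}_n$ is biregular onto $\mathbb{H}\setminus((-\infty,-1]\cup[1,+\infty))$.
   Context: $\mathbb{H}$ is the algebra of quaternions, $\mathbb{S}=\{I\in\mathbb{H}: I^2=-1\}$, $\mathbb{C}_I=\mathbb{R}+\mathbb{R}I$; for $q=\alpha+I\beta$ put $\mathbb{S}_q=\{\alpha+J\beta: J\in\mathbb{S}\}$. A domain (nonempty connected open set) $\Omega\subset\mathbb{H}$ is circular if $\mathbb{S}_q\subset\Omega$ for all $q\in\Omega$; a circular domain is slice if $\Omega\cap\mathbb{R}\ne\emptyset$. A function $f:\Omega\to\mathbb{H}$ is slice regular if $f(\alpha+I\beta)=F_0(\alpha+\sqrt{-1}\beta)+I F_1(\alpha+\sqrt{-1}\beta)$ for all $I\in\mathbb{S}$ and $\alpha,\beta\in\mathbb{R}$ with $\alpha+I\beta\in\Omega$, where $F_0,F_1:\{\alpha+\sqrt{-1}\beta:\alpha+I\beta\in\Omega\}\to\mathbb{H}$ are $C^1$, $F_0(\bar z)=F_0(z)$, $F_1(\bar z)=-F_1(z)$ and $\partial_\alpha F_0=\partial_\beta F_1$, $\partial_\beta F_0=-\partial_\alpha F_1$. It is slice preserving if $f(\Omega\cap\mathbb{C}_I)\subset\mathbb{C}_I$ for all $I\in\mathbb{S}$; $\mathcal{R}_{\mathbb{R}}(\Omega)$ is the set of slice preserving slice regular functions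 on $\Omega$. $\mu:\mathbb{H}\to\mathbb{H}$ is the slice preserving entire function $\mu(q)=\sum_{m\in\mathbb{N}}\frac{(-1)^mq^m}{(2m)!}$ (so $\mu(q^2)=\cos q$). $\mathcal{D}_0:=\{x+yJ: x<\pi^2-\frac{y^2}{4\pi^2},\ J\in\mathbb{S}\}$, and for positive $n\in\mathbb{N}$, $\mathcal{D}_n:=\{x+yJ: n^2\pi^2-\frac{y^2}{4n^2\pi^2}<x<(n+1)^2\pi^2-\frac{y^2}{4(n+1)^2\pi^2},\ J\in\mathbb{S}\}$ (with $x,y\in\mathbb{R}$). A non-constant slice preserving regular function $f$ on a slice domain $\Omega$ is biregular on $\Omega$ if there exists $g\in\mathcal{R}_{\mathbb{R}}(f(\Omega))$ such that $g\circ f=\mathrm{id}_\Omega$ and $f\circ g=\mathrm{id}_{f(\Omega)}$. *)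

(* Defs.v *)
From HB Require Import structures.
From mathcomp Require Import all_boot all_order all_algebra.
From mathcomp Require Import all_classical all_reals all_analysis.
From mathcomp Require Import ring.

Set Implicit Arguments.
Unset Strict Implicit.
Unset Printing Implicit Defensive.

Import Order.TTheory GRing.Theory Num.Theory.
Import numFieldNormedType.Exports.

Local Open Scope classical_set_scope.
Local Open Scope ring_scope.

(* The row vector (a, b, c, d) stands for a + b i + c j + d k. The additive,
   scalar and topological structures are those of row vectors; in particular the
   norm is the sup norm, which is only used through the (Euclidean) topology it
   induces. Row vectors, unlike iterated pairs, carry no ring structure of their
   own that could be confused with the quaternion one. *)
Definition quaternion (R : realType) : Type := 'rV[R]_4.

HB.instance Definition _ (R : realType) :=
  NormedModule.copy (quaternion R) 'rV[R]_4.

Section QuaternionRing.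
Variable R : realType.
Local Notation H := (quaternion R).

Definition quat (a b c d : R) : H := \row_(i < 4) [:: a; b; c; d]`_i.

Definition quat0 (q : H) : R := (q : 'rV_4) 0 0.
Definition quat1 (q : H) : R := (q : 'rV_4) 0 1.
Definition quat2 (q : H) : R := (q : 'rV_4) 0 2.
Definition quat3 (q : H) : R := (q : 'rV_4) 0 3.

Lemma quat_eta (q : H) : quat (quat0 q) (quat1 q) (quat2 q) (quat3 q) = q.
Proof.
by apply/rowP => -[[|[|[|[|//]]]] lti]; rewrite !mxE; congr fun_of_matrix;
  apply/val_inj.
Qed.

Lemma quatK0 a b c d : quat0 (quat a b c d) = a. Proof. by rewrite /quat0 mxE. Qed.
Lemma quatK1 a b c d : quat1 (quat a b c d) = b. Proof. by rewrite /quat1 mxE. Qed.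
Lemma quatK2 a b c d : quat2 (quat a b c d) = c. Proof. by rewrite /quat2 mxE. Qed.
Lemma quatK3 a b c d : quat3 (quat a b c d) = d. Proof. by rewrite /quat3 mxE. Qed.
Definition quatK := (quatK0, quatK1, quatK2, quatK3).

Lemma quat_addE (a b c d a' b' c' d' : R) :
  quat a b c d + quat a' b' c' d' = quat (a + a') (b + b') (c + c') (d + d').
Proof. by apply/rowP => -[[|[|[|[|//]]]] lti]; rewrite !mxE. Qed.

Lemma quat_scaleE (t a b c d : R) :
  t *: quat a b c d = quat (t * a) (t * b) (t * c) (t * d).
Proof. by apply/rowP => -[[|[|[|[|//]]]] lti]; rewrite !mxE. Qed.

Definition quat_one : H := quat 1 0 0 0.

Definition quat_mul (p q : H) : H :=
  let: (a, b, c, d) := (quat0 p, quat1 p, quat2 p, quat3 p) in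
  let: (a', b', c', d') := (quat0 q, quat1 q, quat2 q, quat3 q) in
  quat (a * a' - b * b' - c * c' - d * d')
       (a * b' + b * a' + c * d' - d * c')
       (a * c' - b * d' + c * a' + d * b')
       (a * d' + b * c' - c * b' + d * a').

Lemma quat_mulA : associative quat_mul.
Proof. by move=> p q r; rewrite /quat_mul !quatK; congr quat; ring. Qed.

Lemma quat_mul1q : left_id quat_one quat_mul.
Proof.
by move=> p; rewrite -[RHS]quat_eta /quat_mul !quatK; congr quat; ring.
Qed.

Lemma quat_mulq1 : right_id quat_one quat_mul.
Proof.
by move=> p; rewrite -[RHS]quat_eta /quat_mul !quatK; congr quat; ring.
Qed.

Lemma quat_mulDl : left_distributive quat_mul +%R.
Proof.
move=> p q r; rewrite -(quat_eta p) -(quat_eta q) quat_addE.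
by rewrite /quat_mul !quatK quat_addE; congr quat; ring.
Qed.

Lemma quat_mulDr : right_distributive quat_mul +%R.
Proof.
move=> p q r; rewrite -(quat_eta q) -(quat_eta r) quat_addE.
by rewrite /quat_mul !quatK quat_addE; congr quat; ring.
Qed.

Lemma quat_one_neq0 : quat_one != 0.
Proof.
by apply/eqP => /(congr1 quat0); rewrite quatK /quat0 mxE => /eqP;
  rewrite oner_eq0.
Qed.

HB.instance Definition _ := GRing.Zmodule_isNzRing.Build H
  quat_mulA quat_mul1q quat_mulq1 quat_mulDl quat_mulDr quat_one_neq0.

Lemma quat_mulE (p q : H) : p * q = quat_mul p q.
Proof. by []. Qed.

Lemma quat_scaleAl (t : R) (p q : H) : t *: (p * q) = (t *: p : H) * q.
Proof.
rewrite !quat_mulE -(quat_eta p) quat_scaleE /quat_mul !quatK quat_scaleE.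
by congr quat; ring.
Qed.

Lemma quat_scaleAr (t : R) (p q : H) : t *: (p * q) = p * (t *: q : H).
Proof.
rewrite !quat_mulE -(quat_eta q) quat_scaleE /quat_mul !quatK quat_scaleE.
by congr quat; ring.
Qed.

HB.instance Definition _ := GRing.Lmodule_isLalgebra.Build R H quat_scaleAl.
HB.instance Definition _ := GRing.Lalgebra_isAlgebra.Build R H quat_scaleAr.

End QuaternionRing.

Section SliceRegular.
Variable R : realType.
Local Notation H := (quaternion R).
Implicit Types (Omega : set H) (f g : H -> H) (q I J : H) (x y a b : R).

Definition imag_units : set H := [set I | I ^+ 2 = - 1].

Definition slice_pt a b I : H := a%:A + b *: I.

Definition slice_plane I : set H := [set q | exists a b, q = slice_pt a b I].

Definition sphere_of q : set H :=
  [set p | exists a b I J, [/\ imag_units I, imag_units J,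
     q = slice_pt a b I & p = slice_pt a b J]].

Definition real_set (A : set R) : set H := [set x%:A | x in A].

Definition domain Omega := [/\ Omega !=set0, connected Omega & open Omega].

Definition circular_domain Omega :=
  domain Omega /\ forall q, Omega q -> sphere_of q `<=` Omega.

Definition slice_domain Omega :=
  circular_domain Omega /\ Omega `&` real_set setT !=set0.

(* The complex number a + sqrt(-1) b is encoded as the pair (a, b). *)
Definition stem_domain Omega : set (R * R) :=
  [set z | exists2 I, imag_units I & Omega (slice_pt z.1 z.2 I)].

Definition d_alpha (F : R * R -> H) : R * R -> H := 'D_(1, 0) F.
Definition d_beta (F : R * R -> H) : R * R -> H := 'D_(0, 1) F.

(* Only meaningful for U open, since F is a total function. *)
Definition C1_on (U : set (R * R)) (F : R * R -> H) := forall z, U z ->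
  [/\ derivable F z (1, 0), derivable F z (0, 1),
      {for z, continuous (d_alpha F)} & {for z, continuous (d_beta F)}].

Definition slice_regular Omega f := exists F0 F1 : R * R -> H,
  let U := stem_domain Omega in
  [/\ C1_on U F0 /\ C1_on U F1,
      forall z, U z -> F0 (z.1, - z.2) = F0 z /\ F1 (z.1, - z.2) = - F1 z,
      forall z, U z ->
        d_alpha F0 z = d_beta F1 z /\ d_beta F0 z = - d_alpha F1 z
    & forall a b I, imag_units I -> Omega (slice_pt a b I) ->
        f (slice_pt a b I) = F0 (a, b) + I * F1 (a, b)].

Definition slice_preserving Omega f := forall I, imag_units I ->
  f @` (Omega `&` slice_plane I) `<=` slice_plane I.

(* Functions on Omega are represented by total functions, whose values outside
   Omega are irrelevant. *)
Definition slice_preserving_regular Omega f :=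
  [/\ circular_domain Omega, slice_regular Omega f & slice_preserving Omega f].

Definition biregular Omega f :=
  [/\ slice_domain Omega,
      slice_preserving_regular Omega f,
      ~ (exists c, forall q, Omega q -> f q = c)
    & exists g, [/\ slice_preserving_regular (f @` Omega) g,
        forall q, Omega q -> g (f q) = q
      & forall p, (f @` Omega) p -> f (g p) = p]].

Definition biregular_onto Omega f (Y : set H) :=
  biregular Omega f /\ f @` Omega = Y.

Definition mu q : H :=
  limn (series (fun m : nat => ((-1) ^+ m / (2 * m)`!%:R : R) *: q ^+ m)).

(* Only meaningful for n > 0. *)
Definition parabola (n : nat) y : R :=
  n%:R ^+ 2 * pi ^+ 2 - y ^+ 2 / (4 * n%:R ^+ 2 * pi ^+ 2).

Definition calD (n : nat) : set H :=
  [set q | exists x y J, [/\ imag_units J, q = slice_pt x y J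
    & if n is 0%N then x < pi ^+ 2 - y ^+ 2 / (4 * pi ^+ 2)
      else parabola n y < x < parabola n.+1 y]].

End SliceRegular.

(* Main.v *)
Require Import Defs.
From HB Require Import structures.
From mathcomp Require Import all_boot all_order all_algebra.
From mathcomp Require Import all_classical all_reals all_analysis.
From mathcomp Require Import complex ring lra.

Set Implicit Arguments.
Unset Strict Implicit.
Unset Printing Implicit Defensive.

Import Order.TTheory GRing.Theory Num.Theory.
Import numFieldNormedType.Exports.
Import Normc.

(** The map [mu] unfolds the cosine: [mu (w ^ 2) = cos w]. Write [w = u + i v].
Squaring carries the vertical strip [n pi < u < (n + 1) pi] bijectively onto the
plane region between two confocal parabolas that underlies [calD n]; for [n = 0],
it carries the strip [- pi < u < pi], modulo [w -> - w], onto the inside of a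
single parabola. The cosine carries the same strip bijectively onto the slit
plane. So [mu] is a bijection from the first region to the second, holomorphic
with a nowhere vanishing derivative, and its inverse is holomorphic. All functions
involved commute with complex conjugation, which is what lets them act on every
slice of the quaternions at once.

On the side of [mu], power series with coefficients bounded by inverse factorials
are differentiable term by term ([cderiv_psum]); the exponential series is
identified with its real expression ([psum_expE]), and its even and odd parts at
[i w] give [mu (w ^ 2)] and the derivative of [mu] there ([mu_sqr],
[mu_deriv_neq0]).

The inverse is explicit. If [z = cos (u + i v)], the distances from [z] to [-1]
and [1] are [cosh v + cos u] and [cosh v - cos u]. Hence [cosh v] and [cos u] are
the half-sum and the half-difference of these distances, from which [v] is known
up to sign and [u] is known inside the strip; the sign of [v] is read from that of
the imaginary part of [z]. This formula [mu_inv] is inverse to [mu] on both sides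
([mu_mu_inv], [mu_inv_mu]), and it is continuous on the slit plane, even across
the real axis, where the imaginary part of [(u + i v) ^ 2] vanishes
([mu_inv_ccontinuous]). A continuous inverse of a function with nonzero complex
derivative is differentiable ([cderiv_inverse]).

Finally, a holomorphic function of the plane commuting with conjugation induces
a slice preserving regular function ([slice_preserving_regular_stem]), and the
circular sets involved are domains because each of their points is joined, inside
its slice, to a fixed real point ([slice_domain_polar]). *)

Local Notation Re := (@complex.Re _).
Local Notation Im := (@complex.Im _).

Local Open Scope classical_set_scope.
Local Open Scope ring_scope.

(** * Complex numbers as pairs of reals *)

Section ComplexNumbers.
Variable R : realType.
Local Open Scope complex_scope.
Implicit Types (x y : R[i]) (p : R * R).

Lemma cReD x y : Re (x + y) = Re x + Re y. Proof. case: x y => [a b] [c d]; exact: erefl. Qed.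
Lemma cImD x y : Im (x + y) = Im x + Im y. Proof. case: x y => [a b] [c d]; exact: erefl. Qed.
Lemma cReN x : Re (- x) = - Re x. Proof. case: x => a b; exact: erefl. Qed.
Lemma cImN x : Im (- x) = - Im x. Proof. case: x => a b; exact: erefl. Qed.
Lemma cReM x y : Re (x * y) = Re x * Re y - Im x * Im y.
Proof. case: x y => [a b] [c d]; exact: erefl. Qed.
Lemma cImM x y : Im (x * y) = Re x * Im y + Im x * Re y.
Proof. case: x y => [a b] [c d]; exact: erefl. Qed.
Lemma cReB x y : Re (x - y) = Re x - Re y. Proof. by rewrite cReD cReN. Qed.
Lemma cImB x y : Im (x - y) = Im x - Im y. Proof. by rewrite cImD cImN. Qed.
Lemma Re_realM (a : R) x : Re (a%:C * x) = a * Re x.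
Proof. by rewrite cReM /= mul0r subr0. Qed.
Lemma Im_realM (a : R) x : Im (a%:C * x) = a * Im x.
Proof. by rewrite cImM /= mul0r addr0. Qed.

Lemma complex_eta x : Re x +i* Im x = x. Proof. case: x => a b; exact: erefl. Qed.

Lemma complex_ext x y : Re x = Re y -> Im x = Im y -> x = y.
Proof. by case: x y => [a b] [c d] /= -> ->. Qed.

Lemma normc_ge0 x : 0 <= normc x. Proof. by case: x => a b; exact: sqrtr_ge0. Qed.

Lemma sqr_normcE x : normc x ^+ 2 = Re x ^+ 2 + Im x ^+ 2.
Proof. by case: x => a b; rewrite sqr_sqrtr// addr_ge0 ?sqr_ge0. Qed.

Lemma normcX x n : normc (x ^+ n) = normc x ^+ n.
Proof. by elim: n => [|n IH]; rewrite ?expr0 ?normc1// !exprS normcM IH. Qed.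

Lemma normc_real (a : R) : normc a%:C = `|a|.
Proof. by rewrite /= expr0n/= addr0 sqrtr_sqr. Qed.

Lemma ler_norm_Re x : `|Re x| <= normc x.
Proof.
by rewrite -(@ler_pXn2r _ 2)// ?nnegrE ?normc_ge0// sqr_normcE real_normK ?num_real//
  lerDl sqr_ge0.
Qed.

Lemma ler_norm_Im x : `|Im x| <= normc x.
Proof.
by rewrite -(@ler_pXn2r _ 2)// ?nnegrE ?normc_ge0// sqr_normcE real_normK ?num_real//
  lerDr sqr_ge0.
Qed.

Lemma normcB x y : normc (x - y) = normc (y - x).
Proof. by rewrite -[LHS]normcN opprB. Qed.

Definition cx p : R[i] := p.1 +i* p.2.
Definition uncx x : R * R := (Re x, Im x).

Lemma cxK p : uncx (cx p) = p. Proof. by case: p => a b. Qed.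
Lemma uncxK x : cx (uncx x) = x. Proof. case: x => a b; exact: erefl. Qed.

End ComplexNumbers.

(** * Complex differentiability *)

Section ComplexAnalysis.
Variable R : realType.
Local Open Scope complex_scope.
Implicit Types (z p : R * R) (s : nat -> R[i]).

Definition ccontinuous_at z (f : R * R -> R[i]) :=
  {for z, continuous (Re \o f : R * R -> R)} /\
  {for z, continuous (Im \o f : R * R -> R)}.

Definition ccvg s (l : R[i]) :=
  (Re \o s : R^nat) @ \oo --> Re l /\ (Im \o s : R^nat) @ \oo --> Im l.

(** Complex differentiability, with the plane coded by [R * R] on the side of the
argument so that real partial derivatives apply to [f] as it stands. *)
Definition cderiv (f : R * R -> R[i]) z d := forall e : R, 0 < e ->
  \forall p \near z,
    normc (f p - f z - d * (cx p - cx z)) <= e * normc (cx p - cx z).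

Lemma cvg_normc (T : Type) (F : set_system T) {FF : Filter F} (f : T -> R[i]) l :
  (Re \o f : T -> R) @ F --> Re l -> (Im \o f : T -> R) @ F --> Im l ->
  (@normc R \o f : T -> R) @ F --> normc l.
Proof.
move=> fr fi.
have -> : @normc R \o f = fun t => Num.sqrt ((Re \o f) t ^+ 2 + (Im \o f) t ^+ 2).
  by apply/funext => t /=; case: (f t).
rewrite -(complex_eta l) /=.
apply: continuous_cvg; first exact: sqrt_continuous.
apply: cvgD; rewrite /GRing.exp/=.
  exact: cvgM.
exact: cvgM.
Qed.

Lemma ccontinuous_cvg z f : ccontinuous_at z f ->
  (@uncx R \o f : R * R -> R * R) @ z --> uncx (f z).
Proof.
move=> [fr fi]; exact: (@cvg_pair _ _ _ _ (nbhs (Re (f z))) (nbhs (Im (f z)))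
  _ _ _ (Re \o f) (Im \o f) fr fi).
Qed.

Lemma cx_ccontinuous z : ccontinuous_at z (@cx R).
Proof. by split; [exact: cvg_fst | exact: cvg_snd]. Qed.

Lemma near_normc_cx z e : 0 < e -> \forall p \near z, normc (cx p - cx z) < e.
Proof.
move=> e0; have [c1 c2] := cx_ccontinuous z.
have : (@normc R \o (fun p => cx p - cx z)) p @[p --> z] --> normc (cx z - cx z).
  apply: cvg_normc; rewrite ?cReB ?cImB.
    rewrite (_ : _ \o _ = fun p => (Re \o @cx R) p - Re (cx z)); last first.
      by apply/funext => p.
    by apply: cvgB => //; exact: cvg_cst.
  rewrite (_ : _ \o _ = fun p => (Im \o @cx R) p - Im (cx z)); last first.
    by apply/funext => p.
  by apply: cvgB => //; exact: cvg_cst.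
rewrite subrr normc0 => /cvgr_lt /(_ _ e0); exact: filterS.
Qed.

Lemma cderiv_ccontinuous f z d : cderiv f z d -> ccontinuous_at z f.
Proof.
move=> fd; have K0 : 0 < 1 + normc d by rewrite ltr_wpDr ?normc_ge0.
have H e : 0 < e -> \forall p \near z, normc (f p - f z) < e.
  move=> e0; have h0 : 0 < e / (1 + normc d) by rewrite divr_gt0.
  near=> p.
  have -> : f p - f z = (f p - f z - d * (cx p - cx z)) + d * (cx p - cx z).
    by ring.
  rewrite (le_lt_trans (le_normcD _ _))// normcM.
  apply: (@le_lt_trans _ _ ((1 + normc d) * normc (cx p - cx z))).
    rewrite [leRHS]mulrDl lerD2r; near: p; exact: fd.
  rewrite mulrC -ltr_pdivlMr//; near: p; exact: near_normc_cx.
by split; apply/cvgrPdist_lt => e e0; near=> p; rewrite /= -?cReB -?cImB;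
  [apply: le_lt_trans (ler_norm_Re _) _ | apply: le_lt_trans (ler_norm_Im _) _];
  rewrite normcB; near: p; exact: H.
Unshelve. all: by end_near. Qed.

(** Taken along [(1, 0)] and [(0, 1)], these derivatives satisfy the
Cauchy-Riemann equations. *)
Lemma cderiv_dir f z d v : cderiv f z d ->
  is_derive z v (Re \o f) (Re (d * cx v)) /\ is_derive z v (Im \o f) (Im (d * cx v)).
Proof.
move=> fd.
have K0 : 0 < 1 + normc (cx v) by rewrite ltr_wpDr ?normc_ge0.
have H e : 0 < e -> \forall h \near 0^',
    normc ((h^-1)%:C * (f (h *: v + z) - f z) - d * cx v) < e.
  move=> e0; have e1 : 0 < e / (1 + normc (cx v)) by rewrite divr_gt0.
  have : \forall p \near z,
    normc (f p - f z - d * (cx p - cx z)) <= e / (1 + normc (cx v)) * normc (cx p - cx z).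
    exact: fd.
  rewrite (near_shift 0) subr0 /= => fd1.
  have c0 : (fun h : R => h *: v) h @[h --> 0^'] --> (0 : R * R).
    rewrite -(scale0r v); apply: cvgZr_tmp.
    exact: nbhs_dnbhs.
  have fd2 := c0 _ fd1.
  near=> h.
  have h0 : h != 0 by near: h; exact: nbhs_dnbhs_neq.
  have cxh : cx (h *: v + z) - cx z = h%:C * cx v.
    by apply: complex_ext; rewrite ?Re_realM ?Im_realM /= addrK.
  have hC : h%:C != 0 by rewrite eq_complex /= negb_and h0.
  have -> : (h^-1)%:C * (f (h *: v + z) - f z) - d * cx v =
      (h^-1)%:C * (f (h *: v + z) - f z - d * (cx (h *: v + z) - cx z)).
    by rewrite cxh fmorphV; field.
  rewrite normcM normc_real.
  have : normc (f (h *: v + z) - f z - d * (cx (h *: v + z) - cx z)) <=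
      e / (1 + normc (cx v)) * normc (cx (h *: v + z) - cx z).
    by near: h; exact: fd2.
  rewrite {2}cxh normcM normc_real => hle.
  rewrite normrV ?unitfE// ltr_pdivrMl ?normr_gt0//.
  apply: (le_lt_trans hle); rewrite mulrCA ltr_pM2l ?normr_gt0//.
  rewrite -mulrA gtr_pMr// ltr_pdivrMl// mulr1 ltr_pwDl//.
have key (T : R[i] -> R) : (forall x y, T (x - y) = T x - T y) ->
    (forall (a : R) x, T (a%:C * x) = a * T x) -> (forall x, `|T x| <= normc x) ->
    is_derive z v (T \o f) (T (d * cx v)).
  move=> TB TZ Tn.
  have c : (fun h => h^-1 *: (((T \o f) \o shift z) (h *: v) - (T \o f) z)) @ 0^'
      --> T (d * cx v).
    apply/cvgrPdist_lt => e e0; near=> h.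
    rewrite /= -TB /GRing.scale/= -TZ -TB (le_lt_trans (Tn _))// normcB.
    by near: h; exact: H.
  by apply: DeriveDef; [apply: cvgP; exact: c | apply: cvg_lim].
split; apply: key.
- exact: cReB.
- exact: Re_realM.
- exact: ler_norm_Re.
- exact: cImB.
- exact: Im_realM.
- exact: ler_norm_Im.
Unshelve. all: by end_near. Qed.

(** Because the difference quotients of [f] at [g z] stay away from zero, an
increment of the inverse is controlled by the increment of its argument. *)
Lemma cderiv_inverse (f g : R * R -> R[i]) z d :
  cderiv f (uncx (g z)) d -> d != 0 -> ccontinuous_at z g ->
  (\forall p \near z, f (uncx (g p)) = cx p) -> cderiv g z d^-1.
Proof.
move=> fd d0 gc fg e e0.
have nd0 : 0 < normc d.
  by rewrite lt0r normc_ge0 andbT; apply: contra d0 => /eqP/eq0_normc/eqP.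
(* The first bound keeps the increment of [g] below twice that of its argument
   divided by [normc d]; the second then yields the required error. *)
pose e' := Num.min (normc d / 2) (e * (normc d / 2) * normc d).
have e'0 : 0 < e' by rewrite lt_min !mulr_gt0 ?invr_gt0.
have fgz : f (uncx (g z)) = cx z by exact: nbhs_singleton fg.
have {}fd := ccontinuous_cvg gc (fd _ e'0).
near=> p.
have fgp : f (uncx (g p)) = cx p by near: p.
have : normc (f (uncx (g p)) - f (uncx (g z)) -
    d * (cx (uncx (g p)) - cx (uncx (g z)))) <=
    e' * normc (cx (uncx (g p)) - cx (uncx (g z))).
  by near: p; exact: fd.
rewrite fgp fgz !uncxK; set k := g p - g z; set h := cx p - cx z => le1.
have -> : k - d^-1 * h = - (d^-1 * (h - d * k)) by field.
rewrite normcN normcM normcV ler_pdivrMl//.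
have le2 : normc d * normc k <= normc h + normc d / 2 * normc k.
  rewrite -normcM (_ : d * k = h - (h - d * k)); last by ring.
  rewrite (le_trans (le_normcD _ _))// normcN lerD2l (le_trans le1)//.
  by rewrite ler_wpM2r ?normc_ge0// ge_min lexx.
have le3 : normc k * (normc d / 2) <= normc h by lra.
apply: (le_trans le1).
apply: (@le_trans _ _ (e * (normc d / 2) * normc d * normc k)).
  by rewrite ler_wpM2r ?normc_ge0// ge_min lexx orbT.
rewrite [leLHS](_ : _ = normc d * e * (normc k * (normc d / 2))); last by ring.
by rewrite [leRHS]mulrA ler_wpM2l// mulr_ge0// ltW.
Unshelve. all: by end_near. Qed.

End ComplexAnalysis.

(** * Power series with factorially small coefficients *)

Section PowerSeries.
Variable R : realType.
Local Open Scope complex_scope.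
Implicit Types (z p : R * R) (s : nat -> R[i]) (c : nat -> R).

Lemma Re_sum n (F : nat -> R[i]) :
  Re (\sum_(0 <= k < n) F k) = \sum_(0 <= k < n) Re (F k).
Proof. exact: (big_morph _ (@cReD R) erefl). Qed.

Lemma Im_sum n (F : nat -> R[i]) :
  Im (\sum_(0 <= k < n) F k) = \sum_(0 <= k < n) Im (F k).
Proof. exact: (big_morph _ (@cImD R) erefl). Qed.

Lemma ler_normc_sum n (F : nat -> R[i]) :
  normc (\sum_(0 <= k < n) F k) <= \sum_(0 <= k < n) normc (F k).
Proof.
elim: n => [|n IH]; first by rewrite !big_geq// normc0.
by rewrite !big_nat_recr//= (le_trans (le_normcD _ _))// lerD2r.
Qed.

Lemma ccvg_unique s l l' : ccvg s l -> ccvg s l' -> l = l'.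
Proof.
move=> [r i] [r' i']; apply: complex_ext; first exact: cvg_unique r r'.
exact: cvg_unique i i'.
Qed.

Lemma ccvgD s t (l m : R[i]) : ccvg s l -> ccvg t m -> ccvg (fun n => s n + t n) (l + m).
Proof.
move=> [sr si] [tr ti]; split; rewrite ?cReD ?cImD.
  by rewrite (_ : _ \o _ = (Re \o s) \+ (Re \o t));
    [exact: cvgD | apply/funext => n; exact: cReD].
by rewrite (_ : _ \o _ = (Im \o s) \+ (Im \o t));
  [exact: cvgD | apply/funext => n; exact: cImD].
Qed.

Lemma ccvgZ s (l a : R[i]) : ccvg s l -> ccvg (fun n => a * s n) (a * l).
Proof.
move=> [sr si]; split; rewrite ?cReM ?cImM.
  rewrite (_ : _ \o _ = fun n => Re a * (Re \o s) n - Im a * (Im \o s) n).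
    exact: (cvgB (cvgM (cvg_cst _) sr) (cvgM (cvg_cst _) si)).
  by apply/funext => n; exact: cReM.
rewrite (_ : _ \o _ = fun n => Re a * (Im \o s) n + Im a * (Re \o s) n).
  exact: (cvgD (cvgM (cvg_cst _) si) (cvgM (cvg_cst _) sr)).
by apply/funext => n; exact: cImM.
Qed.

Lemma ccvg_comp s l (h : nat -> nat) : h n @[n --> \oo] --> \oo ->
  ccvg s l -> ccvg (s \o h) l.
Proof. by move=> hoo [sr si]; split; [exact: cvg_comp hoo sr | exact: cvg_comp hoo si]. Qed.

Lemma ccvg_normc_le s l (b : R) :
  (forall n, normc (s n) <= b) -> ccvg s l -> normc l <= b.
Proof.
move=> sb [sr si]; have sl : (@normc R \o s : R^nat) @ \oo --> normc l by exact: cvg_normc.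
rewrite -(cvg_lim _ sl)//; apply: limr_le; first exact: cvgP sl.
by near=> n; exact: sb.
Unshelve. all: by end_near. Qed.

(** Stated with a crude constant, which is harmless against the factorials in
the coefficients of the series below. *)
Lemma normc_expr_taylor1 (r : R) (x y : R[i]) k :
  1 <= r -> normc x <= r -> normc y <= r ->
  normc (y ^+ k - x ^+ k - k%:R * x ^+ k.-1 * (y - x)) <=
    (4 * r) ^+ k * normc (y - x) ^+ 2.
Proof.
move=> r1 xr yr; have r0 : 0 <= r by rewrite (le_trans _ r1).
elim: k => [|k IH].
  by rewrite !expr0 mul0r mul0r subr0 subrr normc0 mul1r sqr_ge0.
have -> : y ^+ k.+1 - x ^+ k.+1 - k.+1%:R * x ^+ k.+1.-1 * (y - x) =
    y * (y ^+ k - x ^+ k - k%:R * x ^+ k.-1 * (y - x)) +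
    k%:R * x ^+ k.-1 * (y - x) ^+ 2.
  case: k {IH} => [|k]; first by rewrite !expr0 !expr1; ring.
  by rewrite /= -!natr1 !exprS; ring.
rewrite (le_trans (le_normcD _ _))// (normcM y) normcM (normcM _%:R) !normcX.
have kC : normc (k%:R : R[i]) = k%:R.
  by rewrite (_ : k%:R = k%:R%:C) ?normc_real ?normr_nat// rmorph_nat.
rewrite kC; set e := normc (y - x) ^+ 2 in IH *.
have e0 : 0 <= e by exact: sqr_ge0.
apply: (@le_trans _ _ (r * ((4 * r) ^+ k * e) + 2 ^+ k * r ^+ k * e)).
  apply: lerD; first by rewrite ler_pM ?normc_ge0.
  rewrite ler_wpM2r// ler_pM ?ler0n ?exprn_ge0 ?normc_ge0//.
    by rewrite -natrX ler_nat ltnW// ltn_expl.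
  rewrite (@le_trans _ _ (r ^+ k.-1))// ?lerXn2r ?nnegrE ?normc_ge0//.
  by rewrite ler_weXn2l// leq_pred.
rewrite [leLHS](_ : _ = (r * (4 * r) ^+ k + 2 ^+ k * r ^+ k) * e); last by ring.
rewrite ler_wpM2r// exprS !exprMn -!mulrA.
have : 2 ^+ k * r ^+ k <= r * (4 ^+ k * r ^+ k).
  rewrite mulrA ler_wpM2r ?exprn_ge0// -[leLHS]mul1r ler_pM ?exprn_ge0//.
  by rewrite lerXn2r ?nnegrE ?ler_nat.
have : 0 <= r * (4 ^+ k * r ^+ k) by rewrite !mulr_ge0 ?exprn_ge0.
set A := _ * (_ * _); set B := _ ^+ _ * _; lra.
Qed.

Definition psum_upto c z n : R[i] := \sum_(0 <= k < n) (c k)%:C * cx z ^+ k.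

Definition psum c z : R[i] :=
  limn (Re \o psum_upto c z : R^nat) +i* limn (Im \o psum_upto c z : R^nat).

Definition fact_bounded c := forall k, `|c k| <= (k`!%:R)^-1.

Lemma fact_bounded_sum c n (r : R) : fact_bounded c -> 0 <= r ->
  \sum_(0 <= k < n) `|c k| * r ^+ k <= expR r.
Proof.
move=> cb r0; apply: (@le_trans _ _ (series (exp_coeff r) n)).
  apply: ler_sum => k _; rewrite /exp_coeff/= mulrC ler_wpM2l ?exprn_ge0//.
apply: nondecreasing_cvgn_le; last exact: is_cvg_series_exp_coeff.
by apply: nondecreasing_series => k _ _; exact: exp_coeff_ge0.
Qed.

Lemma psum_cvg c z : fact_bounded c -> ccvg (psum_upto c z) (psum c z).
Proof.
move=> cb.
have key (T : R[i] -> R) : (forall (a : R) x, T (a%:C * x) = a * T x) ->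
    (forall x, `|T x| <= normc x) ->
    cvgn (series (fun k => T ((c k)%:C * cx z ^+ k))).
  move=> TZ Tn; apply: normed_cvg.
  apply: (series_le_cvg _ _ _ (is_cvg_series_exp_coeff (normc (cx z)))) => k.
  - exact: normr_ge0.
  - exact/exp_coeff_ge0/normc_ge0.
  have : `|T ((c k)%:C * cx z ^+ k)| <= normc (cx z) ^+ k / k`!%:R => //.
  rewrite TZ normrM mulrC -normcX; apply: ler_pM => //; exact: Tn.
split; rewrite /psum /=.
  rewrite (_ : _ \o _ = series (fun k => Re ((c k)%:C * cx z ^+ k))).
    exact: key (@Re_realM R) (@ler_norm_Re R).
  by apply/funext => n; exact: Re_sum.
rewrite (_ : _ \o _ = series (fun k => Im ((c k)%:C * cx z ^+ k))).
  exact: key (@Im_realM R) (@ler_norm_Im R).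
by apply/funext => n; exact: Im_sum.
Qed.

Lemma psum_upto0 c z : psum_upto c z 0 = 0.
Proof. exact: big_nil. Qed.

Lemma psum_uptoS c z n :
  psum_upto c z n.+1 = psum_upto c z n + (c n)%:C * cx z ^+ n.
Proof. exact: big_nat_recr. Qed.

Lemma pseries_diffs_complex c n :
  (pseries_diffs c n)%:C = n.+1%:R * (c n.+1)%:C.
Proof. by rewrite /pseries_diffs rmorphM rmorph_nat. Qed.

Lemma psum_uptoS_diff c z p n :
  psum_upto c p n.+1 - psum_upto c z n.+1
    - psum_upto (pseries_diffs c) z n * (cx p - cx z) =
  \sum_(0 <= k < n.+1) (c k)%:C *
    (cx p ^+ k - cx z ^+ k - k%:R * cx z ^+ k.-1 * (cx p - cx z)).
Proof.
elim: n => [|n IH].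
  rewrite /psum_upto !big_nat1 big_geq//= !expr0.
  by move: (cx p) (cx z) ((c 0%N)%:C) => x y a; ring.
rewrite [RHS]big_nat_recr//= -IH !(psum_uptoS _ _ n.+1) (psum_uptoS (pseries_diffs c)).

move: (psum_upto c p n.+1) (psum_upto c z n.+1) (psum_upto _ z n) => S1 S2 S.
rewrite pseries_diffs_complex (exprS (cx p)) (exprS (cx z)).
move: (cx p) (cx z) ((c n.+1)%:C) => x y a.
by move: (x ^+ n) (y ^+ n) => xn yn; ring.
Qed.

(** The second-order remainders of the monomials add up to at most a multiple of
the squared increment, uniformly on bounded sets. *)
Lemma cderiv_psum c z : fact_bounded c -> fact_bounded (pseries_diffs c) ->
  cderiv (psum c) z (psum (pseries_diffs c) z).
Proof.
move=> cb db e e0; pose r := normc (cx z) + 1; pose M := expR (4 * r).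
have r1 : 1 <= r by rewrite lerDr normc_ge0.
have M0 : 0 < M by exact: expR_gt0.
near=> p.
have p1 : normc (cx p - cx z) < 1 by near: p; exact: near_normc_cx.
have pe : normc (cx p - cx z) < e / M.
  by near: p; apply: near_normc_cx; exact: divr_gt0.
apply: (@le_trans _ _ (M * normc (cx p - cx z) ^+ 2)); last first.
  by rewrite expr2 mulrA ler_wpM2r ?normc_ge0// mulrC -ler_pdivlMr// ltW.
have pr : normc (cx p) <= r.
  rewrite -(subrK (cx z) (cx p)) addrC (le_trans (le_normcD _ _))// lerD2l ltW//.
pose s n := psum_upto c p n.+1 - psum_upto c z n.+1
    - psum_upto (pseries_diffs c) z n * (cx p - cx z).
apply: (@ccvg_normc_le s).
  move=> n; rewrite /s psum_uptoS_diff (le_trans (ler_normc_sum _ _))//.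
  apply: (@le_trans _ _ (\sum_(0 <= k < n.+1)
      `|c k| * (4 * r) ^+ k * normc (cx p - cx z) ^+ 2)).
    apply: ler_sum => k _; rewrite normcM normc_real -[leRHS]mulrA ler_wpM2l//.
    by apply: normc_expr_taylor1 => //; rewrite lerDl.
  rewrite -mulr_suml ler_wpM2r ?sqr_ge0//; apply: fact_bounded_sum => //.
  by rewrite mulr_ge0// (le_trans _ r1).
have shift1 : n.+1 @[n --> \oo] --> \oo.
  rewrite (_ : (fun n => n.+1) = fun n => (n + 1)%N); first exact: (cvg_addnr 1).
  by apply/funext => n; rewrite addn1.
have -> : s = fun n => ((psum_upto c p \o succn) n + (-1) * (psum_upto c z \o succn) n)
   + (- (cx p - cx z)) * psum_upto (pseries_diffs c) z n.
  apply/funext => n; rewrite /s /= mulN1r mulNr; congr (_ - _).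
  by rewrite mulrC.
have -> : psum c p - psum c z - psum (pseries_diffs c) z * (cx p - cx z) =
  (psum c p + (-1) * psum c z) + (- (cx p - cx z)) * psum (pseries_diffs c) z.
  by rewrite mulN1r mulNr [X in _ - X]mulrC.
by apply: ccvgD; [apply: ccvgD; [|apply: ccvgZ]; apply: ccvg_comp => //|apply: ccvgZ];
  exact: psum_cvg.
Unshelve. all: by end_near. Qed.

End PowerSeries.

(** * The exponential series *)

Section Exponential.
Variable R : realType.
Local Open Scope complex_scope.
Implicit Types (z p w : R * R) (c : nat -> R).

Lemma psum0 c : psum c (0, 0) = (c 0%N)%:C.
Proof.
have H n : psum_upto c (0, 0) n.+1 = (c 0%N)%:C.
  elim: n => [|n IH]; first by rewrite /psum_upto big_nat1 expr0 mulr1.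
  by rewrite psum_uptoS IH (_ : cx _ = 0)// expr0n mulr0 addr0.
have key (T : R[i] -> R) : limn (T \o psum_upto c (0, 0) : R^nat) = T (c 0%N)%:C.
  apply/cvg_lim => //; rewrite -cvg_shiftS /= (_ : (fun n => _) = cst (T (c 0%N)%:C)).
    exact: cvg_cst.
  by apply/funext => n /=; rewrite H.
by rewrite /psum !key complex_eta.
Qed.

Lemma is_derive_line (F : R * R -> R) w t d :
  is_derive (t *: w) w F d -> is_derive t (1 : R) (fun s : R => F (s *: w)) d.
Proof.
have E : (fun h : R => h^-1 *: (((fun s : R => F (s *: w)) \o shift t) (h *: 1)
      - F (t *: w))) =
    (fun h => h^-1 *: ((F \o shift (t *: w)) (h *: w) - F (t *: w))).
  by apply/funext => h /=; rewrite scalerDl /GRing.scale/= mulr1.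
case=> dF dE; apply: DeriveDef; first by rewrite /derivable E; exact: dF.
by rewrite /derive E; exact: dE.
Qed.

Definition exp_coef (k : nat) : R := (k`!%:R)^-1.

Lemma exp_coef_bounded : fact_bounded exp_coef.
Proof. by move=> k; rewrite /exp_coef ger0_norm// invr_ge0 ler0n. Qed.

Lemma exp_coef_diffs : pseries_diffs exp_coef = exp_coef.
Proof.
apply/funext => k; rewrite /pseries_diffs /exp_coef factS natrM invfM mulrA.
by rewrite divff ?mul1r// pnatr_eq0.
Qed.

(** The product of the exponential series along a ray with the expected inverse
[exp (- t u) (cos (t v) - i sin (t v))] is constant in [t]. *)
Lemma psum_expE u v :
  psum exp_coef (u, v) = (expR u * cos v) +i* (expR u * sin v).
Proof.
pose w : R * R := (u, v).
pose P t := Re (psum exp_coef (t *: w)); pose Q t := Im (psum exp_coef (t *: w)).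
have [dP dQ] : (forall t : R, is_derive t (1 : R) P (u * P t - v * Q t)) /\
    (forall t : R, is_derive t (1 : R) Q (u * Q t + v * P t)).
  have H t := cderiv_dir w (cderiv_psum (t *: w) exp_coef_bounded
    (eq_ind_r (@fact_bounded R) exp_coef_bounded exp_coef_diffs)).
  split=> t; have [Hr Hi] := H t; rewrite exp_coef_diffs in Hr Hi.
    apply: is_derive_eq; first exact: (is_derive_line Hr).
    by rewrite cReM /P /Q /=; ring.
  apply: is_derive_eq; first exact: (is_derive_line Hi).
  by rewrite cImM /P /Q /=; ring.
have dl (a t : R) : is_derive t (1 : R) (fun s => a * s) a.
  apply: is_derive_eq (@is_deriveZ _ _ _ (@id R) a t 1 1 (is_derive_id t 1)) _.
  by rewrite /GRing.scale/= mulr1.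
have de t := is_derive1_comp (is_derive_expR (- u * t)) (dl (- u) t).
have dc t := is_derive1_comp (is_derive_cos (v * t)) (dl v t).
have ds t := is_derive1_comp (is_derive_sin (v * t)) (dl v t).
pose K t := expR (- u * t) * (cos (v * t) * P t + sin (v * t) * Q t).
pose L t := expR (- u * t) * (cos (v * t) * Q t - sin (v * t) * P t).
have dK t : is_derive t (1 : R) K 0.
  apply: is_derive_eq (is_deriveM (de t) (is_deriveD (is_deriveM (dc t) (dP t))
    (is_deriveM (ds t) (dQ t)))) _.
  by rewrite /GRing.scale/= !fctE /=; ring.
have dL t : is_derive t (1 : R) L 0.
  apply: is_derive_eq (is_deriveM (de t) (is_deriveB (is_deriveM (dc t) (dQ t))
    (is_deriveM (ds t) (dP t)))) _.
  by rewrite /GRing.scale/= !fctE /=; ring.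
have K1 : K 1 = 1.
  rewrite (@is_derive_0_is_cst R K 1 0 dK) /K /P /Q !mulr0 expR0 cos0 sin0 scale0r.
  by rewrite psum0 /exp_coef /= invr1; ring.
have L1 : L 1 = 0.
  rewrite (@is_derive_0_is_cst R L 1 0 dL) /L /P /Q !mulr0 expR0 cos0 sin0 scale0r.
  by rewrite psum0 /exp_coef /= invr1; ring.
rewrite /K /L !mulr1 in K1 L1.
have ee : expR u * expR (- u) = 1 by rewrite expRxMexpNx_1.
have cs := cos2Dsin2 v.
rewrite -[LHS]complex_eta -/w -[w]scale1r -/(P 1) -/(Q 1).
congr Complex.
  have -> : P 1 = (expR u * expR (- u)) * (cos v ^+ 2 + sin v ^+ 2) * P 1.
    by rewrite ee cs !mul1r.
  rewrite [RHS](_ : _ = expR u * (cos v * (expR (- u) * (cos v * P 1 + sin v * Q 1)) -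
    sin v * (expR (- u) * (cos v * Q 1 - sin v * P 1)))); last by rewrite K1 L1; ring.
  by ring.
have -> : Q 1 = (expR u * expR (- u)) * (cos v ^+ 2 + sin v ^+ 2) * Q 1.
  by rewrite ee cs !mul1r.
rewrite [RHS](_ : _ = expR u * (sin v * (expR (- u) * (cos v * P 1 + sin v * Q 1)) +
  cos v * (expR (- u) * (cos v * Q 1 - sin v * P 1)))); last by rewrite K1 L1; ring.
by ring.
Qed.

End Exponential.

(** * The series of [mu] as a cosine *)

Section Cosine.
Variable R : realType.
Local Open Scope complex_scope.
Implicit Types (z p : R * R) (c : nat -> R) (w x : R[i]) (u v : R).

Definition cosh v : R := (expR v + expR (- v)) / 2.
Definition sinh v : R := (expR v - expR (- v)) / 2.

Lemma cosh2Bsinh2 v : cosh v ^+ 2 - sinh v ^+ 2 = 1.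
Proof.
have : expR v * expR (- v) = 1 := expRxMexpNx_1 v.
by rewrite /cosh /sinh; move: (expR v) (expR (- v)) => a b ab; field : ab.
Qed.

Lemma coshN v : cosh (- v) = cosh v.
Proof. by rewrite /cosh opprK addrC. Qed.

Lemma sinhN v : sinh (- v) = - sinh v.
Proof. by rewrite /sinh opprK -mulNr opprB. Qed.

Lemma cosh_gt0 v : 0 < cosh v.
Proof. by rewrite divr_gt0// addr_gt0// expR_gt0. Qed.

Lemma cosh_ge1 v : 1 <= cosh v.
Proof.
have := cosh2Bsinh2 v; have := cosh_gt0 v; have := sqr_ge0 (sinh v).
by nra.
Qed.

Lemma sinh_gt0 v : (0 < sinh v) = (0 < v).
Proof.
rewrite /sinh pmulr_lgt0 ?invr_gt0// subr_gt0 ltr_expR.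
by rewrite -subr_gt0 opprK -mulr2n pmulrn_lgt0.
Qed.

Lemma sinh0 : sinh 0 = 0. Proof. by rewrite /sinh oppr0 subrr mul0r. Qed.

Lemma sinh_eq0 v : (sinh v == 0) = (v == 0).
Proof.
case: (ltgtP v 0) => [v0|v0|->]; last by rewrite sinh0 eqxx.
  have : 0 < sinh (- v) by rewrite sinh_gt0 oppr_gt0.
  by rewrite sinhN oppr_gt0 => /lt_eqF.
by apply: gt_eqF; rewrite sinh_gt0.
Qed.

Definition mu_coef (m : nat) : R := (-1) ^+ m / (2 * m)`!%:R.

(** Coefficients bounded in this way are stable under termwise differentiation,
so the estimates on power series apply to all the derivatives of [mu]. *)
Definition double_fact_bounded c := forall k, `|c k| <= ((2 * k)`!%:R)^-1.

Lemma double_fact_bounded_fact c : double_fact_bounded c -> fact_bounded c.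
Proof.
move=> cb k; apply: (le_trans (cb k)).
by rewrite lef_pV2 ?posrE ?ltr0n ?fact_gt0// ler_nat leq_fact// leq_pmull.
Qed.

Lemma double_fact_bounded_diffs c :
  double_fact_bounded c -> double_fact_bounded (pseries_diffs c).
Proof.
move=> cb k; rewrite /pseries_diffs normrM normr_nat.
apply: (@le_trans _ _ (k.+1%:R * ((2 * k.+1)`!%:R)^-1)); first by rewrite ler_wpM2l.
rewrite ler_pdivrMr ?ltr0n ?fact_gt0// mulrC ler_pdivlMr ?ltr0n ?fact_gt0//.
rewrite -natrM ler_nat mulnS add2n !factS mulnA leq_mul//.
apply: (@leq_trans (2 * k).+2); last by rewrite leq_pmulr.
by rewrite ltnS (leq_trans (leq_pmull k (ltn0Sn 1))).
Qed.

Lemma mu_coef_bounded : double_fact_bounded mu_coef.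
Proof.
move=> k; rewrite /mu_coef normrM normrX normrN1 expr1n mul1r ger0_norm// invr_ge0.
Qed.

Lemma mu_coef_diffsE k :
  pseries_diffs mu_coef k = - ((-1) ^+ k / (2 * (2 * k).+1`!%:R)).
Proof.
rewrite /pseries_diffs /mu_coef exprS mulnS add2n factS natrM.
rewrite (_ : (2 * k).+2%:R = 2 * k.+1%:R :> R); last by rewrite -natrM mulnS.
by rewrite !invfM; field; rewrite nat1r !pnatr_eq0 -lt0n fact_gt0.
Qed.

(** Over an even number of terms the contributions of odd degree cancel in pairs. *)
Lemma exp_upto_even x n :
  psum_upto (@exp_coef R) (uncx x) (n * 2) + psum_upto (@exp_coef R) (uncx (- x)) (n * 2) =
  2 * psum_upto mu_coef (uncx (- x ^+ 2)) n.
Proof.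
elim: n => [|n IH].
  by rewrite mul0n !psum_upto0 addr0 mulr0.
rewrite mulSn !add2n !psum_uptoS !uncxK [RHS]mulrDr -IH.
have -> : (- x ^+ 2) ^+ n = (-1) ^+ n * x ^+ (n * 2).
  by rewrite (exprNn (x ^+ 2)) -exprM (mulnC 2).
have -> : (- x) ^+ (n * 2) = x ^+ (n * 2) by rewrite (exprNn x) -signr_odd oddM andbF mul1r.
have -> : (- x) ^+ (n * 2).+1 = - x ^+ (n * 2).+1.
  by rewrite (exprNn x) -signr_odd /= oddM andbF mulN1r.
have -> : (mu_coef n)%:C = (-1) ^+ n * (exp_coef R (n * 2))%:C.
  by rewrite /mu_coef /exp_coef rmorphM rmorphXn rmorphN1 mulnC.
have : (-1) ^+ n * (-1) ^+ n = 1 :> R[i] by rewrite -expr2 sqrr_sign.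
move: (psum_upto _ _ _) (psum_upto _ (uncx (- x)) _) (exp_coef R (n * 2))%:C.
move: (exp_coef R (n * 2).+1)%:C (x ^+ (n * 2)) (x ^+ (n * 2).+1) ((-1) ^+ n).
move=> b y z e S T a ee.
rewrite [e * a * _](_ : _ = (e * e) * (a * y)); last by ring.
by rewrite ee; ring.
Qed.

Lemma exp_upto_odd x n :
  psum_upto (@exp_coef R) (uncx x) (n * 2) - psum_upto (@exp_coef R) (uncx (- x)) (n * 2) =
  - 4 * x * psum_upto (pseries_diffs mu_coef) (uncx (- x ^+ 2)) n.
Proof.
elim: n => [|n IH].
  by rewrite mul0n !psum_upto0 subr0 mulr0.
rewrite mulSn !add2n !psum_uptoS !uncxK [RHS]mulrDr -IH.
have -> : (- x ^+ 2) ^+ n = (-1) ^+ n * x ^+ (n * 2).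
  by rewrite (exprNn (x ^+ 2)) -exprM (mulnC 2).
have -> : (- x) ^+ (n * 2) = x ^+ (n * 2) by rewrite (exprNn x) -signr_odd oddM andbF mul1r.
have -> : (- x) ^+ (n * 2).+1 = - (x * x ^+ (n * 2)).
  by rewrite (exprNn x) -signr_odd /= oddM andbF mulN1r exprS.
rewrite (exprS x (n * 2)).
have -> : (pseries_diffs mu_coef n)%:C = - ((-1) ^+ n * (2^-1 * (exp_coef R (n * 2).+1)%:C)).
  rewrite mu_coef_diffsE /exp_coef rmorphN rmorphM rmorphXn rmorphN1 invfM rmorphM.
  by rewrite fmorphV rmorph_nat mulnC.
have : (-1) ^+ n * (-1) ^+ n = 1 :> R[i] by rewrite -expr2 sqrr_sign.
move: (psum_upto _ _ _) (psum_upto _ (uncx (- x)) _) (exp_coef R (n * 2))%:C.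
move: (exp_coef R (n * 2).+1)%:C (x ^+ (n * 2)) ((-1) ^+ n).
move=> b y e S T a ee.
rewrite [_ * (- _ * _)](_ : _ = (e * e) * (2 * x * b * y)); last by field.
by rewrite ee; ring.
Qed.

Lemma exp_even x : psum (@exp_coef R) (uncx x) + psum (@exp_coef R) (uncx (- x)) =
  2 * psum mu_coef (uncx (- x ^+ 2)).
Proof.
have c2 := @cvg_mulnr 2 isT.
have c1 := ccvgZ 2 (psum_cvg (uncx (- x ^+ 2)) (double_fact_bounded_fact mu_coef_bounded)).
have h z := ccvg_comp c2 (psum_cvg z (@exp_coef_bounded R)).
have /= c3 := ccvgD (h (uncx x)) (h (uncx (- x))).
apply: ccvg_unique c3 _; under eq_fun do rewrite exp_upto_even; exact: c1.
Qed.

Lemma exp_odd x : psum (@exp_coef R) (uncx x) - psum (@exp_coef R) (uncx (- x)) =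
  - 4 * x * psum (pseries_diffs mu_coef) (uncx (- x ^+ 2)).
Proof.
have c2 := @cvg_mulnr 2 isT.
have c1 := ccvgZ (- 4 * x) (psum_cvg (uncx (- x ^+ 2))
  (double_fact_bounded_fact (double_fact_bounded_diffs mu_coef_bounded))).
have h z := ccvg_comp c2 (psum_cvg z (@exp_coef_bounded R)).
have /= c3 := ccvgD (h (uncx x)) (ccvgZ (-1) (h (uncx (- x)))).
rewrite -[psum _ (uncx (- x))]mul1r -mulNr.
apply: ccvg_unique c3 _; under eq_fun do rewrite mulN1r exp_upto_odd; exact: c1.
Qed.

(** The even part of the exponential series at [i w]: this is the identity
[mu (w ^ 2) = cos w], in real terms. *)
Lemma mu_sqr u v : psum mu_coef (uncx ((u +i* v) ^+ 2)) =
  (cos u * cosh v) +i* (- (sin u * sinh v)).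
Proof.
have := exp_even ((- v) +i* u).
have -> : - ((- v) +i* u) ^+ 2 = (u +i* v) ^+ 2.
  by rewrite !expr2; apply: complex_ext; rewrite ?cReN ?cImN ?cReM ?cImM /=; ring.
rewrite (_ : uncx _ = (- v, u))// (_ : uncx (- _) = (v, - u)); last first.
  by rewrite /uncx cReN cImN /= opprK.
rewrite !psum_expE sinN cosN => e.
have n2 : (2 : R[i]) != 0 by rewrite pnatr_eq0.
apply: (mulfI n2); rewrite -e mulr_natl mulr2n /cosh /sinh.
by apply: complex_ext; rewrite ?cReD ?cImD /=; field.
Qed.

(** The odd part of the exponential series at [i w] gives
[- 2 w mu'(w ^ 2) = sin w], and the sine vanishes only at real points; at [w = 0]
the derivative is [- 1 / 2]. *)
Lemma mu_deriv_neq0 u v : (sin u = 0 -> v = 0 -> u = 0) ->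
  psum (pseries_diffs mu_coef) (uncx ((u +i* v) ^+ 2)) != 0.
Proof.
move=> uv; apply/eqP => d0; have := exp_odd ((- v) +i* u).
have -> : - ((- v) +i* u) ^+ 2 = (u +i* v) ^+ 2.
  by rewrite !expr2; apply: complex_ext; rewrite ?cReN ?cImN ?cReM ?cImM /=; ring.
rewrite d0 mulr0 (_ : uncx _ = (- v, u))// (_ : uncx (- _) = (v, - u)); last first.
  by rewrite /uncx cReN cImN /= opprK.
rewrite !psum_expE sinN cosN => e.
have := congr1 (@complex.Im R) e; have := congr1 (@complex.Re R) e.
rewrite cReB cImB /= => e1 e2.
have su : sin u = 0.
  have : (expR (- v) + expR v) * sin u = 0 by rewrite -[RHS]e2; ring.
  by move=> /eqP; rewrite mulf_eq0 gt_eqF ?addr_gt0 ?expR_gt0// => /eqP.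
have cu : cos u != 0.
  apply/eqP => cu; move: (cos2Dsin2 u); rewrite cu su expr0n addr0 => /eqP.
  by rewrite eq_sym oner_eq0.
have v0 : v = 0.
  have : (expR (- v) - expR v) * cos u = 0 by rewrite -[RHS]e1; ring.
  move=> /eqP; rewrite mulf_eq0 (negPf cu) orbF subr_eq0 => /eqP /expR_inj.
  by move=> /eqP; rewrite eq_sym -subr_eq0 opprK -mulr2n mulrn_eq0 => /eqP.
have u0 := uv su v0.
move: d0; rewrite u0 v0 expr0n /= (_ : uncx _ = (0, 0))// psum0 mu_coef_diffsE => -[] /eqP.
by rewrite oppr_eq0 mulf_eq0 invr_eq0 expr0 oner_eq0 mulf_eq0 !pnatr_eq0.
Qed.

End Cosine.

(** * The plane regions and the inverse of [mu] *)

Section PlanarInverse.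
Variable R : realType.
Local Open Scope complex_scope.
Implicit Types (z p : R * R) (u v x y c C : R) (n : nat).

Definition plane_dom n z : bool :=
  if n is 0%N then z.1 < pi ^+ 2 - z.2 ^+ 2 / (4 * pi ^+ 2)
  else parabola n z.2 < z.1 < parabola n.+1 z.2.

Definition plane_img n z : bool :=
  (z.2 != 0) || ((-1 < z.1) && ((n == 0%N) || (z.1 < 1))).

(** The lower bound is included for [n = 0] only: there [w] and [- w] have the same
square, and the right half of the strip [- pi < u < pi] represents the whole. *)
Definition strip n u : bool :=
  (0 <= u - n%:R * pi < pi) && ((n == 0%N) || (0 < u - n%:R * pi)).

Lemma uncx_sqr u v : uncx ((u +i* v) ^+ 2) = (u ^+ 2 - v ^+ 2, 2 * u * v).
Proof. by rewrite /uncx !expr2 cReM cImM /=; congr pair; ring. Qed.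

(** At the square of [u + i v] the equation of a parabola factors; this is why the
regions between the parabolas are the squares of vertical strips. *)
Lemma parabola_factor m u v : (0 < m)%N ->
  u ^+ 2 - v ^+ 2 - parabola m (2 * u * v) =
  (u ^+ 2 - (m%:R * pi) ^+ 2) * (1 + v ^+ 2 / (m%:R * pi) ^+ 2).
Proof.
move=> m0; rewrite /parabola.
have n0 : m%:R != 0 :> R by rewrite pnatr_eq0 -lt0n.
have p0 : pi != 0 :> R by rewrite gt_eqF// pi_gt0.
by move: pi p0 => a p0; field; rewrite n0 p0.
Qed.

Lemma parabola_lt m u v : (0 < m)%N -> 0 <= u ->
  (u ^+ 2 - v ^+ 2 < parabola m (2 * u * v)) = (u < m%:R * pi).
Proof.
move=> m0 u0; have p0 : 0 < 1 + v ^+ 2 / (m%:R * pi) ^+ 2.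
  by rewrite ltr_pwDl// divr_ge0// sqr_ge0.
rewrite -subr_lt0 parabola_factor// pmulr_llt0// subr_lt0.
by rewrite ltr_pXn2r// nnegrE mulr_ge0// pi_ge0.
Qed.

Lemma parabola_gt m u v : (0 < m)%N -> 0 <= u ->
  (parabola m (2 * u * v) < u ^+ 2 - v ^+ 2) = (m%:R * pi < u).
Proof.
move=> m0 u0; have p0 : 0 < 1 + v ^+ 2 / (m%:R * pi) ^+ 2.
  by rewrite ltr_pwDl// divr_ge0// sqr_ge0.
rewrite -subr_gt0 parabola_factor// pmulr_lgt0// subr_gt0.
by rewrite ltr_pXn2r// nnegrE mulr_ge0// pi_ge0.
Qed.

Lemma strip_ge0 n u : strip n u -> 0 <= u.
Proof.
move=> /andP[/andP[+ _] _]; rewrite subr_ge0; apply: le_trans.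
by rewrite mulr_ge0// pi_ge0.
Qed.

Lemma plane_dom_sqr n u v : 0 <= u ->
  plane_dom n (u ^+ 2 - v ^+ 2, 2 * u * v) = strip n u.
Proof.
move=> u0; rewrite /plane_dom /strip; case: n => [|n] /=.
  have := @parabola_lt 1 u v isT u0; rewrite /parabola expr1n !mul1r mulr1 => ->.
  by rewrite mul0r subr0 u0 andbT.
rewrite parabola_gt// parabola_lt// -[n.+2%:R]natr1 mulrDl mul1r.
by rewrite subr_gt0 subr_ge0 ltrBlDr [pi + _]addrC; case: ltgtP => //=; rewrite ?andbT ?andbF.
Qed.

(** Every point of the plane is the square of a point of the closed right
half-plane, and squaring carries the strip onto the region between the
parabolas. *)
Lemma plane_domP n z :
  reflect (exists u v, strip n u /\ z = uncx ((u +i* v) ^+ 2)) (plane_dom n z).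
Proof.
apply: (iffP idP) => [zD|[u [v [su ->]]]]; last first.
  by rewrite uncx_sqr plane_dom_sqr// (strip_ge0 su).
have [w w0 wz] : exists2 w : R[i], 0 <= Re w & w ^+ 2 = cx z.
  have := sqr_sqrtc (cx z); set w := sqrtc _ => wz.
  have [w0|w0] := leP 0 (Re w); first by exists w.
  by exists (- w); rewrite ?cReN ?oppr_ge0 ?ltW// sqrrN.
exists (Re w), (Im w); rewrite complex_eta wz cxK; split=> //.
by rewrite -(plane_dom_sqr n (Im w) w0) -uncx_sqr complex_eta wz cxK.
Qed.

Lemma cos_shift n u : cos u = (-1) ^+ n * cos (u - n%:R * pi) :> R.
Proof.
rewrite -[u in LHS](subrK (n%:R * pi)) mulr_natl.
exact: (alternatingn (@cosDpi R)).
Qed.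

Lemma sin_shift n u : sin u = (-1) ^+ n * sin (u - n%:R * pi) :> R.
Proof.
rewrite -[u in LHS](subrK (n%:R * pi)) mulr_natl.
exact: (alternatingn (@sinDpi R)).
Qed.

Lemma strip_sin n u : strip n u -> (n = 0%N /\ u = 0) \/ sin u <> 0.
Proof.
move=> /andP[/andP[u0 upi]]; have [u1 _|] := ltP 0 (u - n%:R * pi).
  right; rewrite (sin_shift n) => /eqP; rewrite mulf_eq0 signr_eq0/=.
  by rewrite gt_eqF// sin_gt0_pi// u1.
move=> le0; rewrite orbF => /eqP n0; left; split=> //; move: u0 le0.
by rewrite n0 mul0r subr0 => *; apply/le_anti/andP.
Qed.

Definition arcosh C := ln (C + Num.sqrt (C ^+ 2 - 1)).

Lemma expR_arcosh C : 1 <= C ->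
  expR (arcosh C) = C + Num.sqrt (C ^+ 2 - 1) /\
  expR (- arcosh C) = C - Num.sqrt (C ^+ 2 - 1).
Proof.
move=> C1; have C0 : 0 < C by rewrite (lt_le_trans _ C1).
have s0 : 0 < C + Num.sqrt (C ^+ 2 - 1) by rewrite ltr_pwDl// sqrtr_ge0.
have e : expR (arcosh C) = C + Num.sqrt (C ^+ 2 - 1) by rewrite lnK.
split=> //; apply: (mulfI (lt0r_neq0 s0)).
rewrite -{1}e expRxMexpNx_1 [RHS]mulrC -subr_sqr sqr_sqrtr ?subKr//.
by rewrite subr_ge0 expr_ge1// ltW.
Qed.

Lemma cosh_arcosh C : 1 <= C -> cosh (arcosh C) = C.
Proof. by move=> /expR_arcosh[e1 e2]; rewrite /cosh e1 e2; field. Qed.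

Lemma sinh_arcosh C : 1 <= C -> sinh (arcosh C) = Num.sqrt (C ^+ 2 - 1).
Proof. by move=> /expR_arcosh[e1 e2]; rewrite /sinh e1 e2; field. Qed.

Lemma arcosh_cosh v : arcosh (cosh v) = `|v|.
Proof.
rewrite /arcosh.
have -> : cosh v ^+ 2 - 1 = sinh `|v| ^+ 2.
  rewrite -(cosh2Bsinh2 v); have [_|_] := ger0P v; rewrite ?sinhN; ring.
have -> : cosh v = cosh `|v| by have [_|_] := ger0P v; rewrite ?coshN.
have s0 : 0 <= sinh `|v|.
  by have := normr_ge0 v; rewrite le0r => /orP[/eqP->|?]; rewrite ?sinh0// ltW// sinh_gt0.
rewrite sqrtr_sqr (ger0_norm s0) -[RHS]expRK; congr ln.
by rewrite /cosh /sinh; field.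
Qed.

(** Half the sum and half the difference of the distances to the foci [-1] and
[1]: if the point is [cos (u + i v)], these are [cosh v] and [cos u]. *)
Definition focal_sum z : R := (normc (cx z + 1) + normc (cx z - 1)) / 2.
Definition focal_diff z : R := (normc (cx z + 1) - normc (cx z - 1)) / 2.

Lemma focal_sum_ge1 z : 1 <= focal_sum z.
Proof.
have := le_normcD (cx z + 1) (- (cx z - 1)); rewrite normcN.
rewrite (_ : _ + - _ = 2%:C) ?normc_real.
  by rewrite ger0_norm// /focal_sum; lra.
by rewrite opprB addrC subrKA -mulr2n rmorph_nat.
Qed.

Lemma focal_diff_bound z : -1 <= focal_diff z <= 1.
Proof.
have := le_normcD (cx z - 1) 2%:C; have := le_normcD (cx z + 1) (- 2%:C).
rewrite normcN !normc_real ger0_norm//.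
rewrite (_ : cx z + 1 + - _ = cx z - 1); last first.
  by rewrite rmorph_nat mulr2n opprD addrA addrK.
rewrite (_ : cx z - 1 + _ = cx z + 1); last first.
  by rewrite rmorph_nat mulr2n addrA subrK.
by rewrite /focal_diff => h1 h2; apply/andP; split; lra.
Qed.

Lemma focal_sqr z :
  normc (cx z + 1) ^+ 2 = (z.1 + 1) ^+ 2 + z.2 ^+ 2 /\
  normc (cx z - 1) ^+ 2 = (z.1 - 1) ^+ 2 + z.2 ^+ 2.
Proof. by rewrite !sqr_normcE !cReD !cImD cReN cImN /= subr0 addr0. Qed.

Lemma focal_mul z : focal_sum z * focal_diff z = z.1.
Proof.
have [a b] := focal_sqr z; rewrite /focal_sum /focal_diff.
move: (normc (cx z + 1)) (normc (cx z - 1)) a b => A B a b.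
have -> : (A + B) / 2 * ((A - B) / 2) = (A ^+ 2 - B ^+ 2) / 4 by field.
by rewrite a b; field.
Qed.

Lemma focal_mul_compl z :
  (focal_sum z ^+ 2 - 1) * (1 - focal_diff z ^+ 2) = z.2 ^+ 2.
Proof.
have m := focal_mul z.
rewrite (_ : _ * _ = focal_sum z ^+ 2 + focal_diff z ^+ 2 - 1 -
  (focal_sum z * focal_diff z) ^+ 2); last by ring.
have [a b] := focal_sqr z; rewrite m /focal_sum /focal_diff.
move: (normc (cx z + 1)) (normc (cx z - 1)) a b => A B a b.
rewrite (_ : _ ^+ 2 + _ ^+ 2 = (A ^+ 2 + B ^+ 2) / 2); last by field.
by rewrite a b; field.
Qed.

Lemma focal_cos u v (z := (cos u * cosh v, - (sin u * sinh v)) : R * R) :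
  focal_sum z = cosh v /\ focal_diff z = cos u.
Proof.
have cs := cos2Dsin2 u; have hs := cosh2Bsinh2 v; have [a b] := focal_sqr z.
have c1 := cosh_ge1 v; have c2 := cos_le1 u; have c3 := cos_geN1 u.
have A : normc (cx z + 1) = cosh v + cos u.
  apply/eqP; rewrite -(@eqrXn2 _ 2)// ?normc_ge0//; last by lra.
  rewrite a /= sqrrN exprMn; apply/eqP.
  have -> : sin u ^+ 2 = 1 - cos u ^+ 2 by lra.
  have -> : sinh v ^+ 2 = cosh v ^+ 2 - 1 by lra.
  ring.
have B : normc (cx z - 1) = cosh v - cos u.
  apply/eqP; rewrite -(@eqrXn2 _ 2)// ?normc_ge0//; last by lra.
  rewrite b /= sqrrN exprMn; apply/eqP.
  have -> : sin u ^+ 2 = 1 - cos u ^+ 2 by lra.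
  have -> : sinh v ^+ 2 = cosh v ^+ 2 - 1 by lra.
  ring.
by rewrite /focal_sum /focal_diff A B; split; field.
Qed.

Definition inv_re n z : R := n%:R * pi + acos ((-1) ^+ n * focal_diff z).
Definition inv_im z : R := arcosh (focal_sum z).

(** It must not vanish at [0]: a real point [z > 1] is the cosine of [i v] for some
nonzero [v], and either sign of [v] then gives the same square. *)
Definition upper_sign (q : R) : R := if q < 0 then -1 else 1.

(** The inverse branch of [mu]: the square of the branch of the arccosine with
real part between [n pi] and [(n + 1) pi]. *)
Definition mu_inv n z : R[i] :=
  (inv_re n z +i* (- (-1) ^+ n * upper_sign z.2 * inv_im z)) ^+ 2.

Lemma signM_bound n c : -1 <= c <= 1 -> -1 <= (-1) ^+ n * c <= 1.
Proof. by rewrite -signr_odd; case: odd; rewrite ?mul1r ?mulN1r// => ?; lra. Qed.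

Lemma signM_focal_bound n z : -1 <= (-1) ^+ n * focal_diff z <= 1.
Proof. exact/signM_bound/focal_diff_bound. Qed.

Lemma signMK n c : (-1) ^+ n * ((-1) ^+ n * c) = c.
Proof. by rewrite mulrA -expr2 sqrr_sign mul1r. Qed.

Lemma cos_inv_re n z : cos (inv_re n z) = focal_diff z.
Proof.
rewrite (cos_shift n) /inv_re [_ + acos _]addrC addrK acosK ?signMK// in_itv.
exact: signM_focal_bound.
Qed.

Lemma sin_inv_re n z : sin (inv_re n z) = (-1) ^+ n * Num.sqrt (1 - focal_diff z ^+ 2).
Proof.
rewrite (sin_shift n) /inv_re [_ + acos _]addrC addrK sin_acos ?signM_focal_bound//.
by rewrite exprMn sqrr_sign mul1r.
Qed.

(** The half-difference takes the values [-1] and [1] on the two real half-lines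
beyond the foci; the image leaves out both of them, or only the left one when
[n = 0]. *)
Lemma plane_img_focal n z : plane_img n z ->
  -1 < (-1) ^+ n * focal_diff z /\ (n = 0%N \/ (-1) ^+ n * focal_diff z < 1).
Proof.
have /andP[d1 d2] := focal_diff_bound z; have s1 := focal_sum_ge1 z.
have m := focal_mul z; have mc := focal_mul_compl z.
move: (focal_sum z) (focal_diff z) d1 d2 s1 m mc => C c d1 d2 s1 m mc.
have cN1 : plane_img n z -> -1 < c.
  rewrite lt_neqAle d1 andbT => zY; apply/eqP => c1; move: zY.
  rewrite /plane_img; have -> : z.2 == 0.
    by rewrite -sqrf_eq0 -mc -c1 sqrrN expr1n subrr mulr0.
  by rewrite /= -m -c1 => /andP[+ _]; lra.
have c1 : (0 < n)%N -> plane_img n z -> c < 1.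
  rewrite lt_neqAle d2 andbT => n0 zY; apply/eqP => c1; move: zY.
  rewrite /plane_img; have -> : z.2 == 0.
    by rewrite -sqrf_eq0 -mc c1 expr1n subrr mulr0.
  by rewrite /= -m c1 (gtn_eqF n0)/= => /andP[_]; lra.
move=> zY; have := cN1 zY; case: n c1 zY cN1 => [_ _ _ h|n /(_ isT) c1 /c1 {c1} ? _ ?].
  by rewrite expr0 mul1r; split=> //; left.
by rewrite -signr_odd; case: odd; rewrite ?mul1r ?mulN1r; split; (try right); lra.
Qed.

Lemma strip_inv_re n z : plane_img n z -> strip n (inv_re n z).
Proof.
move=> /plane_img_focal[h1 h2]; have /andP[b1 b2] := signM_focal_bound n z.
rewrite /strip /inv_re [_ + acos _]addrC addrK acos_ge0 ?b1//= acos_ltpi ?h1//=.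
by case: h2 => [->//|h2]; rewrite acos_gt0 ?b1// orbT.
Qed.

Lemma plane_dom_mu_inv n z : plane_img n z -> plane_dom n (uncx (mu_inv n z)).
Proof. move=> zY; apply/plane_domP; exists (inv_re n z); eexists; split; last reflexivity.
exact: strip_inv_re. Qed.

Lemma upper_sign_sqr q : upper_sign q ^+ 2 = 1.
Proof. by rewrite /upper_sign; case: ifP => _; rewrite ?sqrrN ?expr1n. Qed.

Lemma upper_sign_norm q : upper_sign q * `|q| = q.
Proof.
rewrite /upper_sign; case: ltP => q0; first by rewrite ltr0_norm// mulN1r opprK.
by rewrite ger0_norm// mul1r.
Qed.

Lemma sinh_upper_sign q v : sinh (upper_sign q * v) = upper_sign q * sinh v.
Proof. by rewrite /upper_sign; case: ifP => _; rewrite ?mulN1r ?mul1r ?sinhN. Qed.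

Lemma sinh_sign n v : sinh ((-1) ^+ n * v) = (-1) ^+ n * sinh v.
Proof. by rewrite -signr_odd; case: odd; rewrite ?mulN1r ?mul1r ?sinhN. Qed.

Lemma cosh_upper_sign q v : cosh (upper_sign q * v) = cosh v.
Proof. by rewrite /upper_sign; case: ifP => _; rewrite ?mulN1r ?mul1r ?coshN. Qed.

Lemma cosh_sign n v : cosh ((-1) ^+ n * v) = cosh v.
Proof. by rewrite -signr_odd; case: odd; rewrite ?mulN1r ?mul1r ?coshN. Qed.

Lemma mu_mu_inv n z : psum (@mu_coef R) (uncx (mu_inv n z)) = cx z.
Proof.
have s1 := focal_sum_ge1 z.
have ch : cosh (- (-1) ^+ n * upper_sign z.2 * inv_im z) = focal_sum z.
  by rewrite !mulNr coshN -mulrA cosh_sign cosh_upper_sign cosh_arcosh.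
have sh : sinh (- (-1) ^+ n * upper_sign z.2 * inv_im z) =
    - ((-1) ^+ n * (upper_sign z.2 * Num.sqrt (focal_sum z ^+ 2 - 1))).
  by rewrite !mulNr sinhN -mulrA sinh_sign sinh_upper_sign sinh_arcosh.
rewrite /mu_inv mu_sqr cos_inv_re sin_inv_re ch sh mulrC focal_mul.
rewrite (_ : cx z = z.1 +i* z.2)//; congr Complex.
rewrite [LHS](_ : _ = ((-1) ^+ n) ^+ 2 * (upper_sign z.2 *
  (Num.sqrt (focal_sum z ^+ 2 - 1) * Num.sqrt (1 - focal_diff z ^+ 2)))); last by ring.
rewrite sqrr_sign mul1r -sqrtrM; last first.
  by rewrite subr_ge0 expr_ge1// ?focal_sum_ge1// (le_trans _ (focal_sum_ge1 z)).
by rewrite focal_mul_compl sqrtr_sqr upper_sign_norm.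
Qed.

(** Only the sign of [v] is lost in the focal distances; it is recovered from the
ordinate [- sin u * sinh v], since [sin u] keeps its sign on the strip, except at
[u = 0], where [(u + i v) ^ 2] depends on [v ^ 2] only. *)
Lemma mu_inv_mu n z : plane_dom n z -> mu_inv n (uncx (psum (@mu_coef R) z)) = cx z.
Proof.
move=> /plane_domP[u [v [su ->]]]; rewrite uncxK mu_sqr /mu_inv.
have [fs fd] := focal_cos u v; rewrite /inv_re /inv_im /uncx /= fs fd arcosh_cosh.
have /andP[/andP[u0 upi] _] := su.
have -> : acos ((-1) ^+ n * cos u) = u - n%:R * pi.
  by rewrite (cos_shift n) signMK cosK// in_itv/= u0 ltW.
rewrite addrC subrK; case: (strip_sin su) => [[-> ->]|su0].
  rewrite sin0 mul0r oppr0 /upper_sign ltxx expr0 mulr1 mulN1r.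
  apply: complex_ext; rewrite !expr2 ?cReM ?cImM /= ?mul0r ?mulr0 ?addr0 ?sub0r//.
  by rewrite mulrNN -!expr2 real_normK ?num_real.
congr (Complex _ _ ^+ 2).
have s0 : 0 < sin (u - n%:R * pi).
  rewrite lt0r sin_ge0_pi ?u0 ?ltW// andbT; apply/eqP => s0; apply: su0.
  by rewrite (sin_shift n) s0 mulr0.
rewrite (sin_shift n) /upper_sign -signr_odd.
have e1 : - (- sin (u - n%:R * pi) * sinh v) = sin (u - n%:R * pi) * sinh v.
  by rewrite mulNr opprK.
have [v0|v0|->] := ltgtP v 0; last by rewrite normr0 mulr0.
- have hv : sinh v < 0 by rewrite -oppr_gt0 -sinhN sinh_gt0 oppr_gt0.
  have h : sin (u - n%:R * pi) * sinh v < 0 by rewrite pmulr_rlt0.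
  rewrite ltr0_norm//; case: odd => /=.
    by rewrite expr1 mulN1r e1 h; ring.
  by rewrite expr0 mul1r oppr_lt0 ltNge ltW//=; ring.
- have hv : 0 < sinh v by rewrite sinh_gt0.
  have h : 0 < sin (u - n%:R * pi) * sinh v by rewrite pmulr_rgt0.
  rewrite gtr0_norm//; case: odd => /=.
    by rewrite expr1 mulN1r e1 ltNge ltW//=; ring.
  by rewrite expr0 mul1r oppr_lt0 h /=; ring.
Qed.

Lemma plane_img_mu n z : plane_dom n z -> plane_img n (uncx (psum (@mu_coef R) z)).
Proof.
move=> /plane_domP[u [v [su ->]]]; rewrite mu_sqr /plane_img /=.
have [suv|h] := eqVneq (sin u * sinh v) 0; last by rewrite oppr_eq0 h.
rewrite suv oppr0 eqxx /=; move/eqP: suv; rewrite mulf_eq0 sinh_eq0 => suv.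
case: (strip_sin su) => [[-> ->]|su0].
  by rewrite cos0 mul1r eqxx andbT (lt_le_trans _ (cosh_ge1 v))// ltrN10.
have {suv} v0 : v = 0 by move: suv => /orP[/eqP//|/eqP].
rewrite v0 (_ : cosh 0 = 1) ?mulr1; last by rewrite /cosh oppr0 expR0; field.
have : `|cos u| < 1.
  rewrite lt_neqAle cos_max andbT norm_cos_eq1; exact/eqP.
by rewrite ltr_norml => /andP[-> ->]; rewrite orbT.
Qed.

(** A real point of the image comes from a real point of the domain: either its
half-sum of distances is [1] and [v = 0], or [n = 0], its half-difference is [1]
and [u = 0]. *)
Lemma inv_re_im_real n z : plane_img n z -> z.2 = 0 -> inv_re n z * inv_im z = 0.
Proof.
move=> zY z0; apply/eqP; rewrite mulf_eq0.
have [h1 h2] := plane_img_focal zY; have := focal_mul_compl z.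
rewrite z0 expr0n /= => /eqP; rewrite mulf_eq0 => /orP[|].
  rewrite subr_eq0 sqrp_eq1; last by rewrite (le_trans _ (focal_sum_ge1 z)).
  by move=> /eqP e; rewrite /inv_im e /arcosh expr1n subrr sqrtr0 addr0 ln1 eqxx orbT.
rewrite subr_eq0 eq_sym sqrf_eq1 => /orP[]/eqP e; move: h1 h2; rewrite e; case: n {zY}.
- by rewrite /inv_re e expr0 mulr1 acos1 mul0r addr0 eqxx.
- move=> n; rewrite -signr_odd; case: odd => /=.
    by rewrite expr1 mulr1 ltxx.
  by rewrite expr0 mulr1 ltxx => _ [].
- by rewrite expr0 mul1r ltxx.
- move=> n; rewrite -signr_odd; case: odd => /=.
    by rewrite expr1 mulrNN mulr1 ltxx => _ [].
  by rewrite expr0 mul1r ltxx.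
Qed.

Lemma focal_conj z : focal_sum (z.1, - z.2) = focal_sum z /\
  focal_diff (z.1, - z.2) = focal_diff z.
Proof.
rewrite /focal_sum /focal_diff /normc; case: z => p q /=.
by rewrite !oppr0 !addr0 !sqrrN.
Qed.

Lemma mu_inv_conj n z : plane_img n z ->
  mu_inv n (z.1, - z.2) = conjc (mu_inv n z).
Proof.
move=> zY; have [fs fd] := focal_conj z.
rewrite /mu_inv /inv_re /inv_im fs fd -/(inv_re n z) -/(inv_im z).
have h := inv_re_im_real zY.
have conj_sqr (a b : R) : (a +i* (- b)) ^+ 2 = conjc ((a +i* b) ^+ 2).
  by rewrite rmorphXn.
have [z0|z0] := eqVneq z.2 0.
  rewrite z0 oppr0 -conj_sqr !expr2; apply: complex_ext; rewrite ?cReM ?cImM /=.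
    by ring.
  move: h; rewrite /upper_sign ltxx; move: (inv_re n z) (inv_im z) => a b h.
  rewrite (_ : a * _ + _ = - 2 * (-1) ^+ n * (a * b)); last by ring.
  rewrite [RHS](_ : _ = 2 * (-1) ^+ n * (a * b)); last by ring.
  by rewrite h// !mulr0.
rewrite -conj_sqr; congr (Complex _ _ ^+ 2) => /=.
have -> : upper_sign (- z.2) = - upper_sign z.2.
  rewrite /upper_sign oppr_lt0; by case: (ltgtP z.2 0) z0 => //= _ _; rewrite opprK.
ring.
Qed.

End PlanarInverse.

(** * Continuity and differentiability of the inverse *)

Section PlanarContinuity.
Variable R : realType.
Local Open Scope complex_scope.
Implicit Types (z p : R * R) (n : nat).

Lemma continuous_fst : continuous (fun p => p.1 : R).
Proof. by move=> p; exact: cvg_fst. Qed.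

Lemma continuous_snd : continuous (fun p => p.2 : R).
Proof. by move=> p; exact: cvg_snd. Qed.

Lemma near_cont_gt (f : R * R -> R) z (a : R) : {for z, continuous f} ->
  a < f z -> \forall p \near z, a < f p.
Proof. by move=> fc fa; exact: (cvgr_gt (f z) fc). Qed.

Lemma near_cont_lt (f : R * R -> R) z (a : R) : {for z, continuous f} ->
  f z < a -> \forall p \near z, f p < a.
Proof. by move=> fc fa; exact: (cvgr_lt (f z) fc). Qed.

Lemma near_plane_dom n z : plane_dom n z -> \forall p \near z, plane_dom n p.
Proof.
have cpar k : {for z, continuous (fun p : R * R => p.1 - parabola k p.2)}.
  apply: cvgB; first exact: continuous_fst.
  apply: cvgB; first exact: cvg_cst.
  by apply: cvgM; [apply: cvgM; exact: continuous_snd | exact: cvg_cst].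
case: n => [|n] /=.
  have par1 p : pi ^+ 2 - p.2 ^+ 2 / (4 * pi ^+ 2) = parabola 1 p.2 :> R.
    by rewrite /parabola expr1n !mul1r mulr1.
  rewrite /plane_dom par1 -subr_lt0 => h.
  have := near_cont_lt (cpar 1%N) h; apply: filterS => p.
  by rewrite par1 subr_lt0.
move=> /andP[]; rewrite -subr_gt0 -[_ < parabola n.+2 _]subr_lt0 => h1 h2.
have := near_cont_gt (cpar n.+1) h1; have := near_cont_lt (cpar n.+2) h2.
by apply: filterS2 => p; rewrite /plane_dom subr_gt0 subr_lt0 => -> ->.
Qed.

Lemma near_plane_img n z : plane_img n z -> \forall p \near z, plane_img n p.
Proof.
rewrite /plane_img => /orP[z2|/andP[h1 h2]].
  have : \forall p \near z, p.2 != 0.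
    exact: (@cvgr_neq0 R R^o _ (nbhs z) _ (fun p => p.2) z.2 (@continuous_snd z) z2).
  by apply: filterS => p ->.
have := near_cont_gt (@continuous_fst z) h1.
case: n h2 => [|n] /= h2; first by apply: filterS => p ->; rewrite orbT.
have := near_cont_lt (@continuous_fst z) h2.
by apply: filterS2 => p -> ->; rewrite orbT.
Qed.

Lemma continuous_focal z :
  {for z, continuous (@focal_sum R)} /\ {for z, continuous (@focal_diff R)}.
Proof.
have H (a : R) : {for z, continuous (fun p => normc (cx p + a%:C))}.
  apply: (@cvg_normc R _ (nbhs z) _ (fun p => cx p + a%:C)).
    rewrite cReD (_ : _ \o _ = fun p : R * R => p.1 + a); last first.
      by apply/funext.
    by apply: cvgD; [exact: continuous_fst | exact: cvg_cst].
  rewrite cImD (_ : _ \o _ = fun p : R * R => p.2 + 0); last first.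
    by apply/funext.
  by apply: cvgD; [exact: continuous_snd | exact: cvg_cst].
have H1 : {for z, continuous (fun p => normc (cx p + 1))} by exact: (H 1).
have H2 : {for z, continuous (fun p => normc (cx p - 1))}.
  have := H (-1); rewrite (_ : (-1)%:C = -1)//.
  by apply: complex_ext; rewrite ?cReN ?cImN //= oppr0.
split; apply: cvgM; (try exact: cvg_cst).
  by apply: cvgD.
by apply: cvgB.
Qed.

Lemma continuous_inv_im z : {for z, continuous (@inv_im R)}.
Proof.
have [cs _] := continuous_focal z.
apply: (@continuous_comp _ _ _ (@focal_sum R) (@arcosh R)) => //.
have C1 := focal_sum_ge1 z; move: (focal_sum z) C1 => C C1.
apply: (@continuous_comp _ _ _ (fun C : R => C + Num.sqrt (C ^+ 2 - 1)) (@ln R)).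
  apply: cvgD; first exact: cvg_id.
  apply: (@continuous_comp _ _ _ (fun C : R => C ^+ 2 - 1) (@Num.sqrt R)).
    by apply: cvgB; [exact: exprn_continuous | exact: cvg_cst].
  exact: sqrt_continuous.
apply: continuous_ln; rewrite ltr_pwDl ?sqrtr_ge0//.
exact: lt_le_trans C1.
Qed.

(** Continuity at the endpoint [1] of the domain of the arccosine is needed at the
real points [z >= 1], which belong to the image for [n = 0]. *)
Lemma acos_cvg (f : R * R -> R) z : {for z, continuous f} ->
  (forall p, -1 <= f p <= 1) -> -1 < f z -> {for z, continuous (@acos R \o f)}.
Proof.
move=> fc fb fz; have [fz1|] := ltP (f z) 1.
  by apply: continuous_comp => //; apply: continuous_acos; rewrite fz.
move=> fz1; have {}fz1 : f z = 1 by apply/le_anti; have /andP[_ ->] := fb z.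
apply/cvgrPdist_lt => e e0; rewrite /= fz1 acos1.
pose d := Num.min e pi; have d0 : 0 < d by rewrite lt_min e0 pi_gt0.
have dpi : d <= pi by rewrite ge_min lexx orbT.
have dI : d \in `[0, pi] by rewrite in_itv/= ltW.
have cd : cos d < f z.
  by rewrite fz1 -cos0 ltr_cos// in_itv/= lexx pi_ge0.
have := near_cont_gt fc cd; apply: filterS => p hp.
rewrite sub0r normrN ger0_norm ?acos_ge0//.
apply: (@lt_le_trans _ _ d); last by rewrite ge_min lexx.
have ap : acos (f p) \in `[0, pi] by rewrite in_itv/= acos_ge0 ?acos_lepi.
by rewrite -(ltr_cos ap dI) acosK// in_itv/=.
Qed.

Lemma continuous_inv_re n z : plane_img n z -> {for z, continuous (@inv_re R n)}.
Proof.
move=> zY; apply: cvgD; first exact: cvg_cst.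
apply: (@acos_cvg (fun p => (-1) ^+ n * focal_diff p)).
- by apply: cvgM; [exact: cvg_cst | have [_] := continuous_focal z].
- by move=> p; exact: signM_focal_bound.
- by have [] := plane_img_focal zY.
Qed.

Lemma ReIm_mu_inv n z :
  Re (mu_inv n z) = inv_re n z ^+ 2 - inv_im z ^+ 2 /\
  Im (mu_inv n z) = - 2 * (-1) ^+ n * upper_sign z.2 * (inv_re n z * inv_im z).
Proof.
rewrite /mu_inv; split; rewrite expr2 ?cReM ?cImM /=; last by ring.
rewrite -!expr2 !exprMn sqrrN sqrr_sign upper_sign_sqr !mul1r//.
Qed.

(** The sign in the imaginary part jumps only across the real axis, where the
factor [u v] vanishes. *)
Lemma mu_inv_ccontinuous n z : plane_img n z -> ccontinuous_at z (mu_inv n).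
Proof.
move=> zY; have cr := continuous_inv_re zY; have ci := @continuous_inv_im z.
split.
  rewrite (_ : _ \o _ = fun p => inv_re n p * inv_re n p - inv_im p * inv_im p).
    by apply: cvgB; apply: cvgM.
  by apply/funext => p; rewrite -!expr2; have [] := ReIm_mu_inv n p.
have cp : {for z, continuous (fun p => inv_re n p * inv_im p)} by apply: cvgM.
have E p : (Im \o mu_inv n) p =
    - 2 * (-1) ^+ n * upper_sign p.2 * (inv_re n p * inv_im p).
  by have [_] := ReIm_mu_inv n p.
have [z0|z0] := eqVneq z.2 0.
  have uv0 := inv_re_im_real zY z0.
  apply/cvgrPdist_lt => e e0; rewrite !E uv0 mulr0.
  have e2 : 0 < e / 2 by rewrite divr_gt0.
  move/cvgrPdist_lt: cp => /(_ _ e2); apply: filterS => p; rewrite uv0 !sub0r !normrN.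
  rewrite E !normrM normrN normr_sign mulr1 => uv.
  have -> : `|upper_sign p.2| = 1.
    by rewrite /upper_sign; case: ifP => _; rewrite ?normrN1 ?normr1.
  by rewrite mulr1 normr_nat; lra.
have : \forall p \near z, upper_sign p.2 = upper_sign z.2.
  rewrite /upper_sign; have [z2|z2|z2] := ltgtP z.2 0; last by rewrite z2 eqxx in z0.
    by have := near_cont_lt (@continuous_snd z) z2; apply: filterS => p ->.
  have := near_cont_gt (@continuous_snd z) z2; apply: filterS => p p0.
  by rewrite ltNge ltW.
move=> sE.
have c : (fun t => - 2 * (-1) ^+ n * upper_sign z.2 * (inv_re n t * inv_im t)) @ z -->
    (Im \o mu_inv n) z.
  by rewrite E; apply: cvgM => //; exact: cvg_cst.
have d : \forall t \near z, - 2 * (-1) ^+ n * upper_sign z.2 * (inv_re n t * inv_im t) =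
    (Im \o mu_inv n) t.
  near=> t; rewrite E; congr (_ * _ * _); symmetry.
  by near: t; exact: sE.
exact: (cvg_trans (near_eq_cvg d) c).
Unshelve. all: by end_near. Qed.

Lemma mu_cderiv z : cderiv (psum (@mu_coef R)) z (psum (pseries_diffs (@mu_coef R)) z).
Proof.
have b := @mu_coef_bounded R; have b1 := double_fact_bounded_diffs b.
by apply: cderiv_psum; exact: double_fact_bounded_fact.
Qed.

Lemma mu_deriv_ccontinuous z : ccontinuous_at z (psum (pseries_diffs (@mu_coef R))).
Proof.
have b := double_fact_bounded_diffs (@mu_coef_bounded R).
have b1 := double_fact_bounded_diffs b.
by apply: cderiv_ccontinuous; apply: cderiv_psum; exact: double_fact_bounded_fact.
Qed.

Lemma mu_deriv_mu_inv_neq0 n z : plane_img n z ->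
  psum (pseries_diffs (@mu_coef R)) (uncx (mu_inv n z)) != 0.
Proof.
move=> zY; apply: mu_deriv_neq0 => su _.
by have [[]|/(_ su)] := strip_sin (strip_inv_re zY).
Qed.

Lemma mu_inv_cderiv n z : plane_img n z ->
  cderiv (mu_inv n) z (psum (pseries_diffs (@mu_coef R)) (uncx (mu_inv n z)))^-1.
Proof.
move=> zY; apply: cderiv_inverse (mu_cderiv _) _ (mu_inv_ccontinuous zY) _.
  exact: mu_deriv_mu_inv_neq0.
by apply: filterS (near_plane_img zY) => p _; exact: mu_mu_inv.
Qed.

Lemma ccontinuous_comp (f g : R * R -> R[i]) z :
  ccontinuous_at z g -> ccontinuous_at (uncx (g z)) f ->
  ccontinuous_at z (fun p => f (uncx (g p))).
Proof.
move=> /ccontinuous_cvg gc [fr fi].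
by split; [exact: (cvg_comp _ _ gc fr) | exact: (cvg_comp _ _ gc fi)].
Qed.

Lemma ccontinuous_inv (f : R * R -> R[i]) z :
  ccontinuous_at z f -> f z != 0 -> ccontinuous_at z (fun p => (f p)^-1).
Proof.
move=> [fr fi] f0; pose N p := Re (f p) * Re (f p) + Im (f p) * Im (f p).
have Nc : {for z, continuous N} by exact: (cvgD (cvgM fr fr) (cvgM fi fi)).
have N0 : N z != 0.
  rewrite /N -!expr2 -sqr_normcE sqrf_eq0; apply: contra f0 => /eqP/eq0_normc ->.
  by rewrite eqxx.
have NV : {for z, continuous (fun p => (N p)^-1)} by exact: cvgV.
have E p : (f p)^-1 = (Re (f p) * (N p)^-1) +i* (- (Im (f p) * (N p)^-1)).
  by rewrite /N -!expr2; case: (f p).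
split.
  rewrite (_ : _ \o _ = fun p => Re (f p) * (N p)^-1); first exact: (cvgM fr NV).
  by apply/funext => p /=; rewrite E.
rewrite (_ : _ \o _ = fun p => - (Im (f p) * (N p)^-1)); first exact: (cvgN (cvgM fi NV)).
by apply/funext => p /=; rewrite E.
Qed.

Lemma mu_inv_deriv_ccontinuous n z : plane_img n z ->
  ccontinuous_at z (fun p => (psum (pseries_diffs (@mu_coef R)) (uncx (mu_inv n p)))^-1).
Proof.
move=> zY; apply: ccontinuous_inv; last exact: mu_deriv_mu_inv_neq0.
exact: ccontinuous_comp (mu_inv_ccontinuous zY) (mu_deriv_ccontinuous _).
Qed.

Lemma mu_conj z :
  psum (@mu_coef R) (z.1, - z.2) = conjc (psum (@mu_coef R) z).
Proof.
have H c m : psum_upto c (z.1, - z.2) m = conjc (psum_upto c z m).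
  elim: m => [|m IH]; first by rewrite !psum_upto0 rmorph0.
  rewrite !psum_uptoS IH [RHS]rmorphD [X in _ = _ + X]rmorphM; congr (_ + _ * _).
    by rewrite /= oppr0.
  by rewrite [RHS]rmorphXn.
have b := double_fact_bounded_fact (@mu_coef_bounded R).
have [cr ci] := psum_cvg z b.
apply: (ccvg_unique (psum_cvg _ b)); split.
  rewrite (_ : _ \o _ = Re \o psum_upto (@mu_coef R) z); first by case: psum cr.
  by apply/funext => m /=; rewrite H; case: psum_upto.
rewrite (_ : _ \o _ = fun m => - (Im \o psum_upto (@mu_coef R) z) m).
  by rewrite (_ : Im (conjc _) = - Im (psum (@mu_coef R) z)); [exact: cvgN ci | case: psum].
by apply/funext => m /=; rewrite H; case: psum_upto.
Qed.

End PlanarContinuity.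

(** * Slices of the quaternions *)

Section Quaternions.
Variable R : realType.
Local Open Scope complex_scope.
Local Notation H := (quaternion R).
Implicit Types (I J q : H) (x y : R[i]) (z p : R * R) (a b : R).

Definition imag_norm q : R := Num.sqrt (quat1 q ^+ 2 + quat2 q ^+ 2 + quat3 q ^+ 2).

Definition polar q : R * R := (quat0 q, imag_norm q).

Lemma quat_realE a : a%:A = quat a 0 0 0 :> H.
Proof. by rewrite (_ : 1 = quat 1 0 0 0)// quat_scaleE mulr1 !mulr0. Qed.

Lemma quat_slice_pt a b I :
  [/\ quat0 (slice_pt a b I) = a + b * quat0 I, quat1 (slice_pt a b I) = b * quat1 I,
      quat2 (slice_pt a b I) = b * quat2 I & quat3 (slice_pt a b I) = b * quat3 I].
Proof.
rewrite /slice_pt -(quat_eta I) quat_realE.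
by rewrite quat_scaleE quat_addE !quatK !add0r.
Qed.

Lemma imag_unitP I : imag_units I <->
  quat0 I = 0 /\ quat1 I ^+ 2 + quat2 I ^+ 2 + quat3 I ^+ 2 = 1.
Proof.
have N1 : (-1 : H) = quat (-1) 0 0 0.
  by rewrite -quat_realE scaleN1r.
rewrite /imag_units /= expr2 quat_mulE /quat_mul N1; split.
  move=> e; have := congr1 (@quat0 R) e; have := congr1 (@quat1 R) e.
  have := congr1 (@quat2 R) e; have := congr1 (@quat3 R) e; rewrite !quatK.
  move: (quat0 I) (quat1 I) (quat2 I) (quat3 I) => a b c d e3 e2 e1 e0.
  have a0 : a = 0.
    apply/eqP; apply/negPn/negP => a0.
    have b0 : b = 0 by apply: (mulfI a0); lra.
    have c0 : c = 0 by apply: (mulfI a0); lra.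
    have d0 : d = 0 by apply: (mulfI a0); lra.
    by move: e0 (sqr_ge0 a); rewrite b0 c0 d0 expr2; lra.
  by split=> //; move: e0; rewrite a0 !expr2; lra.
move=> [a0 n1]; move: a0 n1.
move: (quat0 I) (quat1 I) (quat2 I) (quat3 I) => a b c d -> n1.
by congr quat; rewrite ?expr2 in n1; lra.
Qed.

Lemma polar_slice_pt a b I : imag_units I -> polar (slice_pt a b I) = (a, `|b|).
Proof.
move=> /imag_unitP[I0 I1]; have [e0 e1 e2 e3] := quat_slice_pt a b I.
rewrite /polar /imag_norm e0 e1 e2 e3 I0 mulr0 addr0 !exprMn -!mulrDr I1 mulr1.
by rewrite sqrtr_sqr.
Qed.

Definition unit_i : H := quat 0 1 0 0.

Lemma imag_unit_i : imag_units unit_i.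
Proof. by apply/imag_unitP; rewrite !quatK expr0n expr1n /= !addr0. Qed.

Lemma slice_ptN a b I : slice_pt a (- b) I = slice_pt a b (- I).
Proof. by rewrite /slice_pt scaleNr scalerN. Qed.

Definition imag_dir q : H :=
  if imag_norm q == 0 then unit_i else (imag_norm q)^-1 *: (q - (quat0 q)%:A).

Lemma sqr_imag_norm q :
  imag_norm q ^+ 2 = quat1 q ^+ 2 + quat2 q ^+ 2 + quat3 q ^+ 2.
Proof. by rewrite sqr_sqrtr// !addr_ge0 ?sqr_ge0. Qed.

Lemma imag_part_quat q : q - (quat0 q)%:A = quat 0 (quat1 q) (quat2 q) (quat3 q).
Proof.
rewrite -[in LHS](quat_eta q) quatK -scaleNr quat_realE.
by rewrite quat_addE subrr !addr0.
Qed.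

Lemma imag_dir_unit q : imag_units (imag_dir q).
Proof.
rewrite /imag_dir; case: ifPn => [_|n0]; first exact: imag_unit_i.
apply/imag_unitP; rewrite imag_part_quat quat_scaleE !quatK mulr0; split=> //.
by rewrite !exprMn -!mulrDr -sqr_imag_norm -exprMn mulVf// expr1n.
Qed.

Lemma polarK q : slice_pt (quat0 q) (imag_norm q) (imag_dir q) = q.
Proof.
rewrite /imag_dir; case: ifPn => [/eqP n0|n0]; last first.
  by rewrite /slice_pt scalerA mulfV// scale1r addrC subrK.
have /esym/eqP := sqr_imag_norm q; rewrite n0 expr0n /=.
rewrite !paddr_eq0 ?addr_ge0 ?sqr_ge0// !sqrf_eq0.
move=> /andP[/andP[/eqP h1 /eqP h2] /eqP h3].
rewrite -[RHS](subrK (quat0 q)%:A) imag_part_quat h1 h2 h3.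
rewrite /slice_pt scale0r addr0 (_ : quat 0 0 0 0 = 0) ?add0r//.
by rewrite -(scale0r (quat 0 0 0 0)) quat_scaleE !mul0r.
Qed.

(** A nonreal quaternion determines its imaginary unit up to sign, and a real one
has [b = 0] for all units. *)
Lemma slice_pt_eq a b a' b' I J : imag_units I -> imag_units J ->
  slice_pt a b I = slice_pt a' b' J -> a = a' /\ `|b| = `|b'|.
Proof.
move=> hI hJ e; have := polar_slice_pt a b hI.
by rewrite e polar_slice_pt// => -[-> ->].
Qed.

Lemma imag_dir_slice_pt a b I : imag_units I -> b != 0 ->
  imag_dir (slice_pt a b I) = if b < 0 then - I else I.
Proof.
move=> hI b0; have [q0 qn] := polar_slice_pt a b hI.
rewrite /imag_dir qn normr_eq0 (negPf b0) q0 /slice_pt addrC addKr scalerA.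
case: ltP => h; first by rewrite ltr0_norm// invrN mulNr mulVf// scaleN1r.
by rewrite ger0_norm// mulVf// scale1r.
Qed.

Definition slice_emb I x : H := slice_pt (Re x) (Im x) I.

Lemma slice_embD I x y : slice_emb I (x + y) = slice_emb I x + slice_emb I y.
Proof. by rewrite /slice_emb /slice_pt cReD cImD !scalerDl addrACA. Qed.

Lemma slice_embM I x y : imag_units I ->
  slice_emb I (x * y) = slice_emb I x * slice_emb I y.
Proof.
move=> hI; have II : I * I = - 1 by rewrite -expr2.
rewrite /slice_emb /slice_pt cReM cImM mulrDl !mulrDr.
rewrite -!scalerAl -!scalerAr !mul1r !mulr1 II !scalerN !scalerA.
by rewrite scalerBl scalerDl [X in _ = _ + X]addrC [RHS]addrACA.
Qed.

Lemma slice_embX I x n : imag_units I -> slice_emb I (x ^+ n) = slice_emb I x ^+ n.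
Proof.
move=> hI; elim: n => [|n IH].
  by rewrite !expr0 /slice_emb /slice_pt /= scale1r scale0r addr0.
by rewrite !exprS slice_embM// IH.
Qed.

Lemma slice_embZ I a x : slice_emb I (a%:C * x) = a *: slice_emb I x.
Proof.
by rewrite /slice_emb /slice_pt Re_realM Im_realM scalerDr !scalerA.
Qed.

Lemma slice_emb_cvg I (s : nat -> R[i]) l : ccvg s l ->
  (fun n => slice_emb I (s n)) @ \oo --> slice_emb I l.
Proof.
move=> [sr si]; apply: cvgD.
  exact: (cvgZ sr (cvg_cst _)).
exact: (cvgZ si (cvg_cst _)).
Qed.

Lemma mu_slice_pt z I : imag_units I ->
  mu (slice_pt z.1 z.2 I) = slice_emb I (psum (@mu_coef R) z).
Proof.
move=> hI; apply/cvg_lim => //.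
rewrite (_ : series _ = fun n => slice_emb I (psum_upto (@mu_coef R) z n)).
  exact: slice_emb_cvg (psum_cvg z (double_fact_bounded_fact (@mu_coef_bounded R))).
apply/funext => n; elim: n => [|n IH].
  by rewrite psum_upto0 /series /= big_nil /slice_emb /slice_pt !scale0r addr0.
rewrite psum_uptoS slice_embD -IH slice_embZ slice_embX//.
by rewrite /series /= big_nat_recr.
Qed.

Lemma mu_slice_emb x I : imag_units I ->
  mu (slice_emb I x) = slice_emb I (psum (@mu_coef R) (uncx x)).
Proof. exact: mu_slice_pt (uncx x) I. Qed.

End Quaternions.

(** * Regular functions induced by holomorphic ones *)

Section Regularity.
Variable R : realType.
Local Open Scope complex_scope.
Local Notation H := (quaternion R).
Implicit Types (I J q : H) (z p v : R * R) (a b : R) (D : R * R -> bool).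

Lemma is_derive_scale_cst (c : H) (f : R * R -> R) z v (d : R) :
  is_derive z v f d -> is_derive z v (fun p => f p *: c) (d *: c).
Proof.
case=> df dE.
have cv : (fun h : R => h^-1 *: (((fun p => f p *: c) \o shift z) (h *: v) - f z *: c))
    @ 0^' --> d *: c.
  rewrite (_ : (fun h => _) =
      fun h : R => (h^-1 *: ((f \o shift z) (h *: v) - f z)) *: c); last first.
    by apply/funext => h /=; rewrite -scalerBl scalerA.
  by apply: cvgZ (cvg_cst _); rewrite -dE; exact: df.
by apply: DeriveDef; [exact: cvgP cv | exact: cvg_lim cv].
Qed.

Arguments is_derive_scale_cst c [f z v d].

Lemma C1_on_stem (U : set (R * R)) (f : R * R -> R) (fa fb : R * R -> R) :
  (forall z, U z -> \forall p \near z, is_derive (p : R * R) ((1, 0) : R * R) f (fa p)) ->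
  (forall z, U z -> \forall p \near z, is_derive (p : R * R) ((0, 1) : R * R) f (fb p)) ->
  (forall z, U z -> {for z, continuous fa} /\ {for z, continuous fb}) ->
  C1_on U (fun p => (f p)%:A : H).
Proof.
have key v (df : R * R -> R) z : (\forall p \near z, is_derive p v f (df p)) ->
    {for z, continuous df} -> {for z, continuous ('D_v (fun p => (f p)%:A : H))}.
  move=> hd hc.
  have E : \forall p \near z, (df p)%:A = 'D_v (fun p => (f p)%:A : H) p.
    by apply: filterS hd => p /(is_derive_scale_cst 1)[_ ->].
  have c : (fun p => (df p)%:A : H) @ z --> 'D_v (fun p => (f p)%:A : H) z.
    by rewrite -(nbhs_singleton E); exact: cvgZ hc (cvg_cst _).
  exact: (cvg_trans (near_eq_cvg E) c).
move=> ha hb hc z Uz; have [ca cb] := hc z Uz.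
have [da _] := is_derive_scale_cst 1 (nbhs_singleton (ha z Uz)).
have [db _] := is_derive_scale_cst 1 (nbhs_singleton (hb z Uz)).
split; [exact: da | exact: db | exact: (key _ fa z (ha z Uz) ca) |].
exact: (key _ fb z (hb z Uz) cb).
Qed.

(** The real and imaginary parts of a holomorphic function that commutes with
conjugation are the two components of a stem, and real components preserve the
slices. *)
Lemma slice_preserving_regular_stem (Omega : set H) (f : H -> H) D
    (phi dphi : R * R -> R[i]) :
  circular_domain Omega ->
  (forall z I, imag_units I -> Omega (slice_pt z.1 z.2 I) <-> D z) ->
  (forall z, D z -> \forall p \near z, D p) ->
  (forall z, D z -> cderiv phi z (dphi z)) ->
  (forall z, D z -> ccontinuous_at z dphi) ->
  (forall z, D z -> phi (z.1, - z.2) = conjc (phi z)) ->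
  (forall z I, imag_units I -> D z -> f (slice_pt z.1 z.2 I) = slice_emb I (phi z)) ->
  slice_preserving_regular Omega f.
Proof.
move=> cO OD Dop dph cph conj fE; split=> //; last first.
  move=> I hI _ [q [Oq [a [b qE]]] <-]; rewrite qE in Oq *.
  have /= -> := fE (a, b) I hI; last by apply/(OD _ _ hI).
  by exists (Re (phi (a, b))), (Im (phi (a, b))).
have stemD z : stem_domain Omega z -> D z by move=> [I hI /(OD _ _ hI)].
have neard z : D z -> \forall p \near z, cderiv phi p (dphi p).
  by move=> Dz; apply: filterS (Dop z Dz) => p; exact: dph.
have cx10 : cx (1, 0) = 1 :> R[i] by [].
have d10 p : cderiv phi p (dphi p) ->
    is_derive p (1, 0) (Re \o phi) (Re (dphi p)) /\
    is_derive p (1, 0) (Im \o phi) (Im (dphi p)).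
  by move=> /(cderiv_dir (1, 0)); rewrite cx10 mulr1.
have d01 p : cderiv phi p (dphi p) ->
    is_derive p (0, 1) (Re \o phi) (- Im (dphi p)) /\
    is_derive p (0, 1) (Im \o phi) (Re (dphi p)).
  move=> /(cderiv_dir (0, 1)); rewrite cReM cImM /= !mulr0 !mulr1.
  by rewrite sub0r addr0.
exists (fun z => (Re (phi z))%:A), (fun z => (Im (phi z))%:A); split.
- split.
    apply: (@C1_on_stem _ (Re \o phi) (Re \o dphi) (fun p => - Im (dphi p))).
    + by move=> z /stemD/neard; apply: filterS => p /d10[].
    + by move=> z /stemD/neard; apply: filterS => p /d01[].
    + by move=> z /stemD/cph[? ci]; split=> //; exact: (cvgN ci).
  apply: (@C1_on_stem _ (Im \o phi) (Im \o dphi) (Re \o dphi)).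
  + by move=> z /stemD/neard; apply: filterS => p /d10[].
  + by move=> z /stemD/neard; apply: filterS => p /d01[].
  + by move=> z /stemD/cph[].
- by move=> z /stemD/conj ->; case: (phi z) => a b /=; rewrite scaleNr.
- move=> z /stemD/dph h; have [h1 h2] := d10 z h; have [h3 h4] := d01 z h.
  have E v (g : R * R -> R) (d : R) : is_derive z v g d ->
      'D_v (fun p => (g p)%:A : H) z = d%:A.
    by move=> /(is_derive_scale_cst 1)[_ ->].
  rewrite /d_alpha /d_beta (E _ _ _ h1) (E _ _ _ h2) (E _ _ _ h3) (E _ _ _ h4).
  by rewrite scaleNr.
move=> a b I hI Oq; have /= -> := fE (a, b) I hI; last by apply/(OD _ _ hI).
by rewrite /slice_emb /slice_pt -scalerAr mulr1.
Qed.

Definition slice_ext (phi : R * R -> R[i]) q : H :=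
  slice_emb (imag_dir q) (phi (polar q)).

(** Commutation with conjugation makes the value independent of the choice of unit:
it compensates for a change of sign, and on the real axis it makes the imaginary
part vanish. *)
Lemma slice_ext_slice_pt phi z I : imag_units I ->
  phi (z.1, - z.2) = conjc (phi z) ->
  slice_ext phi (slice_pt z.1 z.2 I) = slice_emb I (phi z).
Proof.
move=> hI conj; rewrite /slice_ext polar_slice_pt//.
have [z0|z0] := eqVneq z.2 0.
  have im0 : Im (phi z) = 0.
    have := congr1 (@complex.Im R) conj.
    rewrite z0 oppr0 -z0 (_ : (z.1, z.2) = z); last by case: (z).
    by case: (phi z) => u v /=; lra.
  rewrite z0 normr0 -z0 (_ : (z.1, z.2) = z); last by case: (z).
  by rewrite /slice_emb /slice_pt im0 !scale0r.
rewrite imag_dir_slice_pt//; case: ltP => h; last by rewrite ger0_norm//; case: (z).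
rewrite ltr0_norm// conj /slice_emb.
by case: (phi z) => u v /=; rewrite slice_ptN opprK.
Qed.

End Regularity.

(** * Circular domains induced by plane ones *)

Section Domains.
Variable R : realType.
Local Open Scope complex_scope.
Local Notation H := (quaternion R).
Implicit Types (I J q : H) (z p : R * R) (a b : R) (n : nat) (D : R * R -> bool).

Lemma continuous_polar : continuous (@polar R).
Proof.
have c k : continuous (fun q : H => (q : 'rV_4) 0 k) by exact: coord_continuous.
have c2 k : continuous (fun q : H => (q : 'rV_4) 0 k ^+ 2).
  by move=> q; exact: (cvgM (c k q) (c k q)).
move=> q; have h0 : (@quat0 R) @ q --> quat0 q by exact: c.
have h1 : (@imag_norm R) @ q --> imag_norm q.
  exact: (cvg_comp _ _ (cvgD (cvgD (c2 1 q) (c2 2 q)) (c2 3 q)) (@sqrt_continuous R _)).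
exact: (@cvg_pair _ _ _ (nbhs q) (nbhs (quat0 q)) (nbhs (imag_norm q)) _ _ _ _ _ h0 h1).
Qed.

Lemma open_polar D : (forall z, D z -> \forall p \near z, D p) ->
  open [set q : H | D (polar q)].
Proof.
move=> Dop; rewrite openE => q Dq; exact: continuous_polar (Dop _ Dq).
Qed.

Lemma slice_pt_continuous (f g : R -> R) I : continuous f -> continuous g ->
  continuous (fun t => slice_pt (f t) (g t) I).
Proof.
move=> fc gc t; apply: cvgD.
  exact: cvgZ (fc t) (cvg_cst _).
exact: cvgZ (gc t) (cvg_cst _).
Qed.

Lemma connected_paths (E : set H) q0 :
  (forall q, E q -> exists c : R -> H, [/\ continuous c, c 0 = q0, c 1 = q &
     forall t, 0 <= t <= 1 -> E (c t)]) -> connected E.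
Proof.
move=> hE; pose P (c : R -> H) := [/\ continuous c, c 0 = q0 &
  forall t, 0 <= t <= 1 -> E (c t)].
have -> : E = \bigcup_(c in P) (c @` `[0, 1]).
  apply/seteqP; split=> q.
    move=> /hE[c [cc c0 c1 cE]]; exists c => //; exists 1 => //=.
    by rewrite in_itv/= lexx ler01.
  by move=> [c [_ _ cE] [t /= tI <-]]; apply: cE; move: tI; rewrite in_itv.
apply: bigcup_connected.
  by exists q0 => c [_ c0 _]; exists 0 => //=; rewrite in_itv/= lexx ler01.
move=> c [cc _ _]; apply: connected_continuous_connected.
  exact: segment_connected.
exact: continuous_subspaceT.
Qed.

(** Openness passes from the plane set through the continuous map [polar];
connectedness holds because the real point [a0] is common to all the slices. *)
Lemma slice_domain_polar D (Omega : set H) (a0 : R) :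
  (forall z I, imag_units I -> Omega (slice_pt z.1 z.2 I) <-> D z) ->
  (forall z, D z -> \forall p \near z, D p) ->
  (forall z, D z -> exists f g : R -> R, [/\ continuous f, continuous g,
     (f 0, g 0) = (a0, 0), (f 1, g 1) = z & forall t, 0 <= t <= 1 -> D (f t, g t)]) ->
  D (a0, 0) -> slice_domain Omega.
Proof.
move=> OD Dop Dpath D0.
have OP q : Omega q <-> D (polar q).
  rewrite -[X in Omega X](polarK q); exact: OD (polar q) _ (imag_dir_unit q).
have OE : Omega = [set q | D (polar q)] by apply/seteqP; split=> q /OP.
have realE : slice_pt a0 0 (unit_i R) = a0%:A by rewrite /slice_pt scale0r addr0.
have O0 : Omega a0%:A.
  by rewrite -realE; apply/(OD (a0, 0) _ (imag_unit_i R)).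
split; last by exists a0%:A; split=> //; exists a0.
split; last first.
  move=> q Oq p [a [b [I [J [hI hJ qE ->]]]]]; apply/(OD (a, b) _ hJ)/(OD (a, b) _ hI).
  by rewrite -qE.
split; first by exists a0%:A.
  apply: (@connected_paths _ a0%:A) => q Oq.
  have /Dpath[f [g [fc gc [f0 g0] [f1 g1] fg]]] : D (polar q) by move: Oq; rewrite OE.
  exists (fun t => slice_pt (f t) (g t) (imag_dir q)); split.
  - exact: slice_pt_continuous.
  - by rewrite f0 g0 /slice_pt scale0r addr0.
  - by rewrite f1 g1 polarK.
  - by move=> t t01; apply/(OD (f t, g t) _ (imag_dir_unit q))/fg.
by rewrite OE; exact: open_polar.
Qed.

End Domains.

(** * Biregularity of [mu] *)

Section Biregularity.
Variable R : realType.
Local Open Scope complex_scope.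
Local Notation H := (quaternion R).
Implicit Types (I J q : H) (z p : R * R) (a b u v t : R) (n : nat).

Definition slit n : set H :=
  ~` (real_set `]-oo, -1] `|` if n is 0%N then set0 else real_set `[1, +oo[).

Lemma calD_slice_pt n z I : imag_units I ->
  calD n (slice_pt z.1 z.2 I) <-> plane_dom n z.
Proof.
move=> hI; split=> [[x [y [J [hJ /(slice_pt_eq hI hJ)[zx zy]]]]]|].
  have e : y ^+ 2 = z.2 ^+ 2 by rewrite -[LHS]real_normK ?num_real// -zy real_normK ?num_real.
  by rewrite /plane_dom /parabola -zx e; case: n.
by rewrite /plane_dom => h; exists z.1, z.2, I; split=> //; case: n h.
Qed.

Lemma real_set_slice_pt (A : set R) a b I : imag_units I ->
  real_set A (slice_pt a b I) <-> b = 0 /\ A a.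
Proof.
move=> hI; split=> [[x Ax]|[-> Aa]]; last first.
  by exists a => //; rewrite /slice_pt scale0r addr0.
rewrite (_ : x%:A = slice_pt x 0 I); last by rewrite /slice_pt scale0r addr0.
move=> /(slice_pt_eq hI hI)[<- /esym]; rewrite normr0 => /eqP.
by rewrite normr_eq0 => /eqP ->.
Qed.

Lemma slit_slice_pt n z I : imag_units I ->
  slit n (slice_pt z.1 z.2 I) <-> plane_img n z.
Proof.
move=> hI; have rI A := real_set_slice_pt A z.1 z.2 hI.
rewrite /plane_img; split.
  move=> h; have [z2|] := eqVneq z.2 0; last by [].
  rewrite /=; apply/andP; split.
    by rewrite ltNge; apply/negP => z1; apply: h; left; apply/rI; rewrite /= in_itv.
  case: n h => //= n h; rewrite ltNge; apply/negP => z1; apply: h; right.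
  by apply/rI; rewrite /= in_itv/= andbT.
move=> h [/rI[z2]|].
  rewrite /= in_itv/= leNgt => /negP; move: h.
  by rewrite z2 eqxx /= => /andP[].
case: n h => //= n h /rI[z2]; rewrite /= in_itv/= andbT leNgt => /negP; move: h.
by rewrite z2 eqxx /= => /andP[].
Qed.

Lemma strip_convex n u u' t : 0 <= t <= 1 -> strip n u -> strip n u' ->
  strip n (u + t * (u' - u)).
Proof.
move=> /andP[t0 t1] /andP[/andP[u0 u1] u2] /andP[/andP[u0' u1'] u2'].
rewrite /strip; set w := u - n%:R * pi in u0 u1 u2; set w' := u' - n%:R * pi in u0' u1' u2'.
have -> : u + t * (u' - u) - n%:R * pi = (1 - t) * w + t * w' by rewrite /w /w'; ring.
have s0 : 0 <= 1 - t by rewrite subr_ge0.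
have pos (x y : R) : 0 < x -> 0 < y -> 0 < (1 - t) * x + t * y.
  move=> x0 y0; have [->|tn] := eqVneq t 0; first by rewrite subr0 mul1r mul0r addr0.
  have tp : 0 < t by rewrite lt0r tn.
  by rewrite ltr_wpDl ?mulr_ge0 ?mulr_gt0// ltW.
rewrite addr_ge0 ?mulr_ge0//= -subr_gt0.
have -> : pi - ((1 - t) * w + t * w') = (1 - t) * (pi - w) + t * (pi - w') by ring.
rewrite (pos (pi - w) (pi - w')) ?subr_gt0//=; move: u2 u2'.
by case: (n == 0%N) => //= h h'; exact: pos.
Qed.

Definition strip_mid n : R := n%:R * pi + pi / 2.

Lemma strip_mid_in n : strip n (strip_mid n).
Proof.
have p0 := pi_gt0 R; rewrite /strip /strip_mid [_ * _ + _]addrC addrK.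
have h : 0 < pi / 2 :> R by rewrite divr_gt0.
by rewrite ltW//= h orbT andbT ltr_pdivrMr// mulr_natr mulr2n ltrDl.
Qed.

Lemma plane_dom_mid n : plane_dom n (strip_mid n ^+ 2, 0).
Proof.
apply/plane_domP; exists (strip_mid n), 0; split; first exact: strip_mid_in.
by rewrite uncx_sqr mulr0 expr0n subr0.
Qed.

(** The path is the square of the segment that joins the middle of the strip to a
square root of [z]: the region itself is not convex for [0 < n], but the strip is. *)
Lemma plane_dom_path n z : plane_dom n z -> exists f g : R -> R,
  [/\ continuous f, continuous g, (f 0, g 0) = (strip_mid n ^+ 2, 0), (f 1, g 1) = z &
    forall t, 0 <= t <= 1 -> plane_dom n (f t, g t)].
Proof.
move=> /plane_domP[u [v [su ->]]]; rewrite uncx_sqr.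
pose U t := strip_mid n + t * (u - strip_mid n); pose V t : R := t * v.
have Uc : continuous U.
  by move=> t; apply: cvgD; [exact: cvg_cst | apply: cvgM; [exact: cvg_id | exact: cvg_cst]].
have Vc : continuous V by move=> t; apply: cvgM; [exact: cvg_id | exact: cvg_cst].
exists (fun t => U t ^+ 2 - V t ^+ 2), (fun t => 2 * U t * V t); split.
- by move=> t; exact: (cvgB (cvgM (Uc t) (Uc t)) (cvgM (Vc t) (Vc t))).
- by move=> t; exact: (cvgM (cvgM (cvg_cst _) (Uc t)) (Vc t)).
- by rewrite /U /V !mul0r addr0 mulr0 expr0n subr0.
- by rewrite /U /V !mul1r [_ + (u - _)]addrC subrK.
move=> t t01; have sU : strip n (U t) by exact: strip_convex t01 (strip_mid_in n) su.
by rewrite plane_dom_sqr// (strip_ge0 sU).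
Qed.

(** The slit plane is star-shaped with respect to [0]. *)
Lemma plane_img_path n z : plane_img n z -> exists f g : R -> R,
  [/\ continuous f, continuous g, (f 0, g 0) = (0, 0), (f 1, g 1) = z &
    forall t, 0 <= t <= 1 -> plane_img n (f t, g t)].
Proof.
have mc (c : R) : continuous (fun t : R => t * c).
  by move=> t; apply: cvgM; [exact: cvg_id | exact: cvg_cst].
move=> zY; exists (fun t => t * z.1), (fun t => t * z.2); split.
- exact: mc.
- exact: mc.
- by rewrite !mul0r.
- by rewrite !mul1r; case: (z).
move=> t /andP[t0 t1]; rewrite /plane_img /= mulf_eq0 negb_or.
have [->|tn] := eqVneq t 0; first by rewrite /= !mul0r ltrN10 ltr01 orbT.
move: zY; rewrite /plane_img; case: (z.2 != 0) => //= /andP[h1 h2].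
apply/andP; split; first by nra.
by case/orP: h2 => [->//|h2]; apply/orP; right; nra.
Qed.

Lemma plane_img0 n : plane_img n ((0, 0) : R * R).
Proof. by rewrite /plane_img /= eqxx /= ltrN10 ltr01 orbT. Qed.

Lemma mu_image n : @mu R @` calD n = slit n.
Proof.
apply/seteqP; split=> q.
  move=> [p]; rewrite -(polarK p) => /(calD_slice_pt n (polar p) (imag_dir_unit p)) pD <-.
  rewrite (mu_slice_pt (polar p) (imag_dir_unit p)).
  apply/(slit_slice_pt n (uncx _) (imag_dir_unit p)); exact: plane_img_mu.
rewrite -(polarK q) => /(slit_slice_pt n (polar q) (imag_dir_unit q)) qY.
exists (slice_emb (imag_dir q) (mu_inv n (polar q))).
  apply/(calD_slice_pt n (uncx (mu_inv n (polar q))) (imag_dir_unit q)).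
  exact: plane_dom_mu_inv.
by rewrite (mu_slice_emb _ (imag_dir_unit q)) mu_mu_inv.
Qed.

Lemma biregular_onto_mu n : biregular_onto (calD n) (@mu R) (slit n).
Proof.
have DP z I : imag_units I -> calD n (slice_pt z.1 z.2 I) <-> plane_dom n z.
  exact: calD_slice_pt.
have YP z I : imag_units I -> slit n (slice_pt z.1 z.2 I) <-> plane_img n z.
  exact: slit_slice_pt.
have Dslice : slice_domain (@calD R n).
  exact: (slice_domain_polar DP (@near_plane_dom R n) (@plane_dom_path n) (plane_dom_mid n)).
have Yslice : slice_domain (slit n).
  exact: (slice_domain_polar YP (@near_plane_img R n) (@plane_img_path n) (plane_img0 n)).
split; last exact: mu_image.
split => //.
- apply: (slice_preserving_regular_stem (proj1 Dslice) DP (@near_plane_dom R n)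
    (phi := psum (@mu_coef R)) (dphi := psum (pseries_diffs (@mu_coef R)))).
  + by move=> z _; exact: mu_cderiv.
  + by move=> z _; exact: mu_deriv_ccontinuous.
  + by move=> z _; exact: mu_conj.
  + by move=> z I hI _; exact: mu_slice_pt.
(* The values [0] and [unit_i] are both taken. *)
- move=> [c hc].
  have hq q : slit n q -> q = c by rewrite -mu_image => -[p /hc -> ->].
  have h0 : slit n (slice_pt 0 0 (unit_i R)).
    by apply/(YP (0, 0) _ (imag_unit_i R)); exact: plane_img0.
  have h1 : slit n (slice_pt 0 1 (unit_i R)).
    by apply/(YP (0, 1) _ (imag_unit_i R)); rewrite /plane_img oner_eq0.
  have := slice_pt_eq (imag_unit_i R) (imag_unit_i R) (etrans (hq _ h0) (esym (hq _ h1))).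
  by rewrite normr0 normr1 => -[_ /esym/eqP]; rewrite oner_eq0.
have gE z I : imag_units I -> plane_img n z ->
    slice_ext (mu_inv n) (slice_pt z.1 z.2 I) = slice_emb I (mu_inv n z).
  by move=> hI zY; apply: slice_ext_slice_pt => //; exact: mu_inv_conj.
have gE' x I : imag_units I -> plane_img n (uncx x) ->
    slice_ext (mu_inv n) (slice_emb I x) = slice_emb I (mu_inv n (uncx x)).
  exact: gE (uncx x) I.
exists (slice_ext (mu_inv n)); rewrite mu_image; split.
- apply: (slice_preserving_regular_stem (proj1 Yslice) YP (@near_plane_img R n)
    (phi := mu_inv n)
    (dphi := fun z => (psum (pseries_diffs (@mu_coef R)) (uncx (mu_inv n z)))^-1)) => //.
  + by move=> z zY; exact: mu_inv_cderiv.
  + by move=> z zY; exact: mu_inv_deriv_ccontinuous.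
  + by move=> z zY; exact: mu_inv_conj.
- move=> q; rewrite -(polarK q) => /(DP (polar q) _ (imag_dir_unit q)) qD.
  rewrite (mu_slice_pt (polar q) (imag_dir_unit q)) gE' ?mu_inv_mu//.
    exact: imag_dir_unit.
  exact: plane_img_mu.
- move=> q; rewrite -(polarK q) => /(YP (polar q) _ (imag_dir_unit q)) qY.
  rewrite (gE (polar q))//; last exact: imag_dir_unit.
  by rewrite (mu_slice_emb _ (imag_dir_unit q)) mu_mu_inv.
Qed.

End Biregularity.

Theorem theorem3p3 (R : realType) :
  biregular_onto (calD 0) (@mu R) (~` real_set `]-oo, -1]) /\
  (forall n : nat, (0 < n)%N ->
    biregular_onto (calD n) (@mu R)
      (~` (real_set `]-oo, -1] `|` real_set `[1, +oo[))).
Proof.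
split; last by case=> // n _; exact: biregular_onto_mu n.+1.
by have := @biregular_onto_mu R 0; rewrite /slit setU0.
Qed.
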